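(* Consider the stochastic approximation process with expanding projections $(\theta_i,X_i)_{i\ge 0}$ described in the context, and suppose that condition (W) holds with constants $(\xi_i)_{i\ge0}$ and $\alpha_w\in(0,\infty)$. Suppose $\Gamma_i\equiv c_0\,i^{-\eta}$ for all $i\ge1$ with some $c_0<\infty$ and $\eta\in(1/2,1]$, that $\pi_\theta=\pi_{\theta'}$ for all $\theta,\theta'\in\hat\Theta$, and that the following hold for a measurable $V:\mathsf{X}\to[1,\infty)$: (a) there are constants $c<\infty$, $\beta_H\in(0,1/2]$ and $\alpha_H,\alpha_V\in[0,\infty)$ such that for all $i\ge 0$ and $(\theta,x)\in\mathcal{R}_0\times\mathsf{X}$: $\sup_{\theta'\in\mathcal{R}_i}|H(\theta',x)|\le c\,\xi_i^{\alpha_H}V^{\beta_H}(x)$ and $\mathbb{E}_{\theta,x}[V(X_i)]\le c\,\xi_i^{\alpha_V}V(x)$; (b) the ergodicity condition (G) of the context holds, with constants $\alpha_M,\alpha_\rho\in[0,\infty)$; (c) the continuity condition (C) of the context holds, with constants $\alpha_D,\beta_D,\alpha_\Delta,\beta_\Delta$, and $\beta_D,\beta_\Delta\in(0,1/\beta_H-1]$; (d) the projections satisfy $|\theta_{i+1}-\theta_i|\le|\theta_{i+1}^*-\theta_i|$ for all $i\ge0$; (e) $$\sum_{i=1}^\infty i^{-(1+\beta_D)\eta}\,\xi_i^{\alpha_w+2\alpha_M+2\alpha_\rho+\alpha_D+(\beta_D+1)(\beta_H+\alpha_V+\alpha_H)}<\infty,$$ $$\sum_{i=1}^\infty i^{-(1+\beta_\Delta)\eta}\,\xi_i^{\alpha_w+\alpha_M+\alpha_\rho+\alpha_\Delta+\beta_\Delta\alpha_H+(\beta_\Delta+1)\beta_H\alpha_V}<\infty,$$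 $$\sum_{i=1}^\infty i^{-2\eta}\,\xi_i^{2\alpha_w+2(\alpha_H+\alpha_M+\alpha_\rho+\beta_H+\alpha_V)}<\infty .$$ Then condition (P) stated in the context holds.
   Context: Setting. Let $\Theta\subset\mathbb{R}^d$ and let $(\mathsf{X},\mathcal{B}(\mathsf{X}))$ be a measurable space. Let $\{P_\theta\}_{\theta\in\Theta}$ be a family of Markov transition probabilities on $\mathsf{X}$; for each $\theta\in\hat\Theta$ (defined below) $P_\theta$ admits a unique invariant probability measure $\pi_\theta$. Let $H:\Theta\times\mathsf{X}\to\mathbb{R}^d$ be measurable, $h(\theta):=\int_{\mathsf{X}}H(\theta,x)\,\pi_\theta(\mathrm{d}x)$, $\bar H(\theta,x):=H(\theta,x)-h(\theta)$. $\langle\cdot,\cdot\rangle$ and $|\cdot|$ are the standard inner product and norm on $\mathbb{R}^d$; $a\vee b:=\max\{a,b\}$. For measurable $f:\mathsf{X}\to\mathbb{R}^d$ and $r>0$, $\|f\|_{V^r}:=\sup_x|f(x)|/V^r(x)$. Write $P^k(x,f)=P^kf(x)$. Process. Let $\{\mathcal{R}_i\}_{i\ge0}$ be subsets of $\Theta$ and let $(\Gamma_i)_{i\ge1}$ be nonnegative random variables. For a starting point $(\theta_0,X_0)\equiv(\theta,x)\in\mathcal{R}_0\times\mathsf{X}$ and recursively for $i\ge0$: $X_{i+1}\mid\mathcal{F}_i\sim P_{\theta_i}(X_i,\cdot)$; $\theta_{i+1}^*=\theta_i+\Gamma_{i+1}H(\theta_i,X_{i+1})$; $\theta_{i+1}=\theta_{i+1}^*\mathbb{I}\{\theta_{i+1}^*\in\mathcal{R}_{i+1}\}+\theta_{i+1}^{\mathrm{proj}}\mathbb{I}\{\theta_{i+1}^*\notin\mathcal{R}_{i+1}\}$,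 where $\mathcal{F}_i=\sigma(\theta_0,X_0,\theta_1,X_1,\Gamma_1,\ldots,\theta_i,X_i,\Gamma_i)$ and $\theta_{i+1}^{\mathrm{proj}}$ is a $\sigma(\mathcal{F}_i,X_{i+1},\theta_{i+1}^* )$-measurable random variable taking values in $\mathcal{R}_{i+1}$. $\mathbb{P}_{\theta,x}$, $\mathbb{E}_{\theta,x}$ denote the law of the process started at $(\theta,x)$ and the expectation; $\mathbb{E}:=\mathbb{E}_{\theta,x}$ whenever the expectation does not depend on $(\theta,x)$. $\mathcal{W}_M:=\{\theta\in\Theta:w(\theta)\le M\}$. Condition (W). There exists a twice continuously differentiable $w:\Theta\to[0,\infty)$ such that (i) $\sup_{\theta\in\Theta}\sup_{|\theta_0|=1}|\mathrm{Hess}_w(\theta)\theta_0|<\infty$; (ii) $\mathcal{R}_i\subset\mathcal{R}_{i+1}$ for all $i\ge0$, and $\hat\Theta:=\bigcup_{i=0}^\infty\mathcal{R}_i\subset\Theta$; (iii) there is $M_0>0$ such that $\langle\nabla w(\theta),h(\theta)\rangle\le0$ for any $\theta\in\mathcal{W}_{M_0}^c\cap\hat\Theta$; (iv) for all $i\ge1$, whenever $\theta_i^*\notin\mathcal{R}_i$: $\theta_i^{\mathrm{proj}}\in\mathcal{R}_i$ and $w(\theta_i^{\mathrm{proj}})\le w(\theta_i^* )$, $\mathbb{P}_{\theta,x}$-a.s.; (v) there are constants $\alpha_w,c\in[0,\infty)$ and a non-decreasing sequence $\xi_i\in[1,\infty)$ with $\sup_{\theta\in\mathcal{R}_i}|\nabla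 w(\theta)|\le c\,\xi_i^{\alpha_w}$ for all $i\ge0$. Condition (G). For any $r\in(0,1]$ and $\theta\in\hat\Theta$ there exist $M_{\theta,r}\in[0,\infty)$ and $\rho_{\theta,r}\in(0,1)$ such that for any $f$ with $\|f\|_{V^r}<\infty$, $|P_\theta^k(x,f)-\pi_\theta(f)|\le V^r(x)\|f\|_{V^r}M_{\theta,r}\rho_{\theta,r}^k$ for all $k\ge0$, $x\in\mathsf{X}$; and these satisfy, for all $i\ge 0$, $\sup_{\theta\in\mathcal{R}_i}M_{\theta,r}\le c_r\xi_i^{\alpha_M}$ and $\sup_{\theta\in\mathcal{R}_i}(1-\rho_{\theta,r})^{-1}\le c_r\xi_i^{\alpha_\rho}$ for some constants $\alpha_M,\alpha_\rho\in[0,\infty)$ and a constant $c_r\in[0,\infty)$ depending only on $r$. Condition (C). For any $\theta,\theta'\in\hat\Theta$ and $r\in(0,1]$ there is $D_{\theta,\theta',r}\in[0,\infty)$, and there is $\beta_D\in(0,\infty)$ independent of $\theta,\theta',r$, such that for any $f$ with $\|f\|_{V^r}<\infty$, $\|P_\theta f-P_{\theta'}f\|_{V^r}\le\|f\|_{V^r}D_{\theta,\theta',r}|\theta-\theta'|^{\beta_D}$; and for all $i\ge 0$, $\sup_{(\theta,\theta')\in\mathcal{R}_i^2}D_{\theta,\theta',r}\le c_r^D\xi_i^{\alpha_D}$ with $\alpha_D\in[0,\infty)$ and $c_r^D\in[0,\infty)$ depending only on $r$. Moreover there are constants $c<\infty$, $\alpha_\Delta\in[0,\infty)$, $\beta_\Delta>0$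 such that for all $i\ge 0$, and all $(\theta,\theta')\in\mathcal{R}_i^2$, $\|H(\theta,\cdot)-H(\theta',\cdot)\|_{V^{\beta_H}}\le c\,\xi_i^{\alpha_\Delta}|\theta-\theta'|^{\beta_\Delta}$. Condition (P). Condition (W) holds with $(\xi_i)_{i\ge0}$ and $\alpha_w\in(0,\infty)$. For all $\theta\in\hat\Theta$ a solution $g_\theta:\mathsf{X}\to\mathbb{R}^d$ to the Poisson equation $g_\theta(x)-P_\theta g_\theta(x)\equiv\bar H(\theta,x)$ exists and for all $i\ge0$ the step size $\Gamma_{i+1}$ is independent of $\mathcal{F}_i$ and $X_{i+1}$. Moreover there exist a measurable $V:\mathsf{X}\to[1,\infty)$ and constants $c<\infty$, $\beta_H,\beta_g\in[0,1/2]$, $\alpha_g,\alpha_H,\alpha_V\in[0,\infty)$ such that for all $(\theta,x)\in\mathcal{R}_0\times\mathsf{X}$ (and all $i\ge0$ in (i)–(iii)) (i) $\sup_{\theta\in\mathcal{R}_i}|H(\theta,x)|\le c\,\xi_i^{\alpha_H}V^{\beta_H}(x)$; (ii) $\mathbb{E}_{\theta,x}[V(X_i)]\le c\,\xi_i^{\alpha_V}V(x)$; (iii) $\sup_{\theta\in\mathcal{R}_i}[|g_\theta(x)|+|P_\theta g_\theta(x)|]\le c\,\xi_i^{\alpha_g}V^{\beta_g}(x)$; (iv) $\sum_{i\ge1}\mathbb{E}[\Gamma_{i+1}]\xi_i^{\alpha_w}\mathbb{E}_{\theta,x}[|P_{\theta_i}g_{\theta_i}(X_i)-P_{\theta_{i-1}}g_{\theta_{i-1}}(X_i)|]<\infty$;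 (v) $\sum_{i\ge1}\mathbb{E}[\Gamma_i^2]\xi_i^{2\alpha_w+2((\alpha_H+\beta_H\alpha_V)\vee(\alpha_g+\beta_g\alpha_V))}<\infty$; (vi) $\sum_{i\ge1}\mathbb{E}[\Gamma_{i+1}\Gamma_i]\xi_i^{\alpha_H+\alpha_g+(\beta_H+\beta_g)\alpha_V}<\infty$; (vii) $\sum_{i\ge1}|\mathbb{E}[\Gamma_{i+1}-\Gamma_i]|\xi_i^{\alpha_w+\alpha_g+\beta_g\alpha_V}<\infty$. *)

(* Defs.v *)
From HB Require Import structures.
From mathcomp Require Import all_boot all_order all_algebra.
From mathcomp Require Import all_classical all_reals all_analysis.
From mathcomp Require Import measurable_realfun.
Set Implicit Arguments.
Unset Strict Implicit.
Unset Printing Implicit Defensive.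
Import Order.TTheory GRing.Theory Num.Theory.
Import numFieldNormedType.Exports.
Local Open Scope classical_set_scope.
Local Open Scope ring_scope.

(* The Borel sigma-algebra of R^d, presented as the product sigma-algebra, as
   the library does for tuples. *)
Definition measure_rV_display : measure_display -> measure_display.
Proof. exact. Qed.

Section measurable_rV.
Context {R : realType} (d : nat).

Let coors : 'I_d -> 'rV[R]_d -> R := fun j u => u ord0 j.

Let rV_set0 : g_sigma_preimage coors set0.
Proof. exact: sigma_algebra0. Qed.

Let rV_setC A : g_sigma_preimage coors A -> g_sigma_preimage coors (~` A).
Proof. exact: sigma_algebraC. Qed.

Let rV_bigcup (F : nat -> set 'rV[R]_d) :
  (forall i, g_sigma_preimage coors (F i)) ->
  g_sigma_preimage coors (\bigcup_i F i).
Proof. exact: sigma_algebra_bigcup. Qed.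

HB.instance Definition _ :=
  @isMeasurable.Build (measure_rV_display default_measure_display)
    'rV[R]_d (g_sigma_preimage coors) rV_set0 rV_setC rV_bigcup.

End measurable_rV.

Section euclidean.
Context {R : realType} {d : nat}.
Implicit Types (u v x : 'rV[R]_d) (w : 'rV[R]_d -> R).

Definition dotp u v : R := \sum_(j < d) u ord0 j * v ord0 j.

(* The norm `|u| of the library on 'rV[R]_d is the sup norm. *)
Definition enorm u : R := Num.sqrt (dotp u u).

Definition unit_sphere : set 'rV[R]_d := [set u | enorm u = 1].

Definition grad w x : 'rV[R]_d := \row_j 'D_(delta_mx 0 j) w x.

Definition hess w x : 'M[R]_d := 'J (grad w) x.

(* Twice continuous differentiability on an arbitrary subset of R^d: as usual,
   on an open neighbourhood of it. *)
Definition twice_cdiff_on (D : set 'rV[R]_d) w :=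
  exists U : set 'rV[R]_d, [/\ open U, D `<=` U &
    forall x, U x -> [/\ differentiable (w : 'rV[R]_d -> R^o) x,
      differentiable (grad w) x & {for x, continuous (hess w)}]].

End euclidean.

(* Measurability on D for the trace sigma-algebra; D itself need not be
   measurable ([measurable_fun D f] says nothing for such a D). *)
Definition trace_measurable_fun d1 d2 (T : measurableType d1)
    (U : measurableType d2) (D : set T) (f : T -> U) :=
  forall B, measurable B ->
    exists2 C, measurable C & D `&` f @^-1` B = D `&` C.

Definition sigma_of dO (Om : measurableType dO) dY (Y : measurableType dY)
  (Z : Om -> Y) : set_system Om := preimage_set_system setT Z measurable.

Definition independent_of dO (Om : measurableType dO) (R : realType)
    (mu : probability Om R) (G : set_system Om) (Z : Om -> R) :=
  forall E B, G E -> measurable B ->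
    mu (E `&` Z @^-1` B) = (mu E * mu (Z @^-1` B))%E.

Section vector_functions.
Context {R : realType} {d : nat} {dX : measure_display} {X : measurableType dX}.

Definition vint (mu : {measure set X -> \bar R}) (f : X -> 'rV[R]_d) :
  'rV[R]_d := \row_j (\int[mu]_x f x ord0 j).

Definition vnorm (V : X -> R) (r : R) (f : X -> 'rV[R]_d) : \bar R :=
  ereal_sup [set (enorm (f x) / V x `^ r)%:E | x in [set: X]].

End vector_functions.

(* The last five fields are indexed by the starting point (theta, x): [law] is
   P_{theta,x}, and [param], [chain], [gain], [proj_point] are the sequences theta_i,
   X_i, Gamma_i, theta_i^proj of the process started there.  [gain] and [proj_point]
   are only meaningful at indices i >= 1; [kern], [stat] and [drift], which are
   P_theta, pi_theta and H, only for theta in [Theta] ([stat]: in [hatTheta]). *)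
Record scheme (R : realType) (d : nat) (dX : measure_display)
    (X : measurableType dX) (dO : measure_display) (Om : measurableType dO) :=
  Scheme {
    Theta : set 'rV[R]_d ;
    kern : 'rV[R]_d -> R.-pker X ~> X ;
    stat : 'rV[R]_d -> probability X R ;
    drift : 'rV[R]_d -> X -> 'rV[R]_d ;
    proj_set : nat -> set 'rV[R]_d ;
    law : 'rV[R]_d -> X -> probability Om R ;
    param : 'rV[R]_d -> X -> nat -> Om -> 'rV[R]_d ;
    chain : 'rV[R]_d -> X -> nat -> Om -> X ;
    gain : 'rV[R]_d -> X -> nat -> Om -> R ;
    proj_point : 'rV[R]_d -> X -> nat -> Om -> 'rV[R]_d
  }.

Section stochastic_approximation.
Context {R : realType} {d : nat} {dX : measure_display} {X : measurableType dX}
  {dO : measure_display} {Om : measurableType dO}.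
Variable S : scheme R d X Om.
Implicit Types (t : 'rV[R]_d) (x : X) (i : nat) (f : X -> 'rV[R]_d)
  (V : X -> R) (xi : nat -> R).

Definition hatTheta : set 'rV[R]_d := \bigcup_i proj_set S i.

Definition kop t f : X -> 'rV[R]_d := fun x => vint (kern S t x) f.

Definition mean_field t : 'rV[R]_d := vint (stat S t) (drift S t).

(* theta_i^*, for i >= 1 *)
Definition param_star t x i : Om -> 'rV[R]_d := fun om =>
  param S t x i.-1 om
  + gain S t x i om *: drift S (param S t x i.-1 om) (chain S t x i om).

Definition filt t x i : set_system Om :=
  <<s \bigcup_(j in [set j | (j <= i)%N])
        (sigma_of (param S t x j) `|` sigma_of (chain S t x j))
      `|` \bigcup_(j in [set j | (1 <= j <= i)%N]) sigma_of (gain S t x j) >>.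

Definition filt_chain t x i : set_system Om :=
  <<s filt t x i `|` sigma_of (chain S t x i.+1) >>.

Definition filt_star t x i : set_system Om :=
  <<s filt_chain t x i `|` sigma_of (param_star t x i.+1) >>.

Definition invariant_law t (mu : probability X R) :=
  forall A, measurable A -> (\int[mu]_x kern S t x A)%E = mu A.

(* Joint measurability of (theta, x) |-> P_theta(x, A) is what makes
   P_{theta_i}(X_i, A) a random variable. *)
Definition setting :=
  [/\ [/\ forall i, proj_set S i `<=` Theta S & proj_set S 0 !=set0],
      trace_measurable_fun (Theta S `*` [set: X])
        (fun z : 'rV[R]_d * X => drift S z.1 z.2),
      forall A, measurable A -> trace_measurable_fun (Theta S `*` [set: X])
        (fun z : 'rV[R]_d * X => kern S z.1 z.2 A) &
      forall t, hatTheta t -> invariant_law t (stat S t) /\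
        forall mu : probability X R, invariant_law t mu ->
          forall A, measurable A -> mu A = stat S t A].

Definition process_from t x :=
  [/\ forall om, param S t x 0 om = t /\ chain S t x 0 om = x,
      [/\ forall i, measurable_fun setT (param S t x i),
          forall i, measurable_fun setT (chain S t x i) &
          forall i, (1 <= i)%N -> measurable_fun setT (gain S t x i) /\
            forall om, 0 <= gain S t x i om],
      forall i A E, measurable A -> filt t x i E ->
        law S t x (E `&` chain S t x i.+1 @^-1` A) =
        (\int[law S t x]_(om in E)
           kern S (param S t x i om) (chain S t x i om) A)%E,
      forall i om, param S t x i.+1 om =
        if param_star t x i.+1 om \in proj_set S i.+1
        then param_star t x i.+1 om else proj_point S t x i.+1 om &
      forall i, (forall om, proj_set S i.+1 (proj_point S t x i.+1 om)) /\
        forall B, measurable B -> filt_star t x i (proj_point S t x i.+1 @^-1` B)].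

Definition sa_process :=
  setting /\ forall t x, proj_set S 0 t -> process_from t x.

Definition sublevel (w : 'rV[R]_d -> R) (M : R) : set 'rV[R]_d :=
  [set t | Theta S t /\ w t <= M].

(* [w] is a function on [Theta] only: its values elsewhere play no role, and
   w(theta_i^* ) presupposes theta_i^* \in Theta. *)
Definition cond_W xi (alphaw : R) :=
  exists w : 'rV[R]_d -> R,
  [/\ [/\ twice_cdiff_on (Theta S) w, forall t, Theta S t -> 0 <= w t &
       (ereal_sup [set (enorm (u *m hess w t))%:E |
           t in Theta S & u in unit_sphere] < +oo)%E],
      (forall i, proj_set S i `<=` proj_set S i.+1) /\ hatTheta `<=` Theta S,
      exists2 M0 : R, 0 < M0 & forall t, (~` sublevel w M0 `&` hatTheta) t ->
        dotp (grad w t) (mean_field t) <= 0,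
      forall t x i, proj_set S 0 t -> (1 <= i)%N ->
        {ae law S t x, forall om, ~ proj_set S i (param_star t x i om) ->
          [/\ Theta S (param_star t x i om), proj_set S i (proj_point S t x i om) &
              w (proj_point S t x i om) <= w (param_star t x i om)]} &
      [/\ 0 <= alphaw, forall i, 1 <= xi i, forall i j, (i <= j)%N -> xi i <= xi j &
       exists2 c : R, 0 <= c & forall i,
         (ereal_sup [set (enorm (grad w t))%:E | t in proj_set S i]
            <= (c * xi i `^ alphaw)%:E)%E]].

Definition cond_G V xi (alphaM alpharho : R) :=
  [/\ 0 <= alphaM, 0 <= alpharho &
  forall r : R, 0 < r <= 1 ->
  exists (M rho : 'rV[R]_d -> R) (c : R),
  [/\ 0 <= c,
      forall t, hatTheta t -> 0 <= M t /\ 0 < rho t < 1,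
      forall t, hatTheta t -> forall f, measurable_fun setT f ->
        (vnorm V r f < +oo)%E -> forall k x,
        ((enorm (iter k (kop t) f x - vint (stat S t) f))%:E
          <= (V x `^ r)%:E * vnorm V r f * (M t * rho t ^+ k)%:E)%E &
      forall i,
        (ereal_sup [set (M t)%:E | t in proj_set S i]
          <= (c * xi i `^ alphaM)%:E)%E /\
        (ereal_sup [set ((1 - rho t)^-1)%:E | t in proj_set S i]
          <= (c * xi i `^ alpharho)%:E)%E]].

Definition cond_C V xi (betaH alphaD betaD alphaDelta betaDelta : R) :=
  [/\ [/\ 0 <= alphaD, 0 < betaD, 0 <= alphaDelta & 0 < betaDelta],
  forall r : R, 0 < r <= 1 ->
  exists (D : 'rV[R]_d -> 'rV[R]_d -> R) (c : R),
  [/\ 0 <= c,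
      forall t t', hatTheta t -> hatTheta t' -> 0 <= D t t',
      forall t t', hatTheta t -> hatTheta t' ->
        forall f, measurable_fun setT f -> (vnorm V r f < +oo)%E ->
        (vnorm V r (fun x => (kop t f x - kop t' f x)%R)
          <= vnorm V r f * (D t t' * enorm (t - t') `^ betaD)%:E)%E &
      forall i,
        (ereal_sup [set (D t t')%:E | t in proj_set S i & t' in proj_set S i]
          <= (c * xi i `^ alphaD)%:E)%E] &
  exists c : R, forall i t t', proj_set S i t -> proj_set S i t' ->
    (vnorm V betaH (fun x => (drift S t x - drift S t' x)%R)
      <= (c * xi i `^ alphaDelta * enorm (t - t') `^ betaDelta)%:E)%E].

Definition drift_bound V xi (c alphaH betaH : R) :=
  forall i t x, proj_set S 0 t ->
    (ereal_sup [set (enorm (drift S t' x))%:E | t' in proj_set S i]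
      <= (c * xi i `^ alphaH * V x `^ betaH)%:E)%E.

Definition moment_bound V xi (c alphaV : R) :=
  forall i t x, proj_set S 0 t ->
    ('E_(law S t x)[fun om => V (chain S t x i om)]
      <= (c * xi i `^ alphaV * V x)%:E)%E.

(* The integrability clause makes P_theta g well defined. *)
Definition poisson_solution t (g : X -> 'rV[R]_d) :=
  [/\ measurable_fun setT g,
      forall x j, (kern S t x).-integrable setT (fun y => (g y ord0 j)%:E) &
      forall x, g x - kop t g x = drift S t x - mean_field t].

(* |P_{theta_i} g_{theta_i}(X_i) - P_{theta_{i-1}} g_{theta_{i-1}}(X_i)| *)
Definition poisson_increment (g : 'rV[R]_d -> X -> 'rV[R]_d) t x i : Om -> R :=
  fun om => enorm
    (kop (param S t x i om) (g (param S t x i om)) (chain S t x i om)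
     - kop (param S t x i.-1 om) (g (param S t x i.-1 om)) (chain S t x i om)).

Definition cond_P xi (alphaw : R) :=
  [/\ 0 < alphaw, cond_W xi alphaw,
      forall t x i, proj_set S 0 t ->
        independent_of (law S t x) (filt_chain t x i) (gain S t x i.+1) &
  exists g : 'rV[R]_d -> X -> 'rV[R]_d,
  (forall t, hatTheta t -> poisson_solution t (g t)) /\
  exists V : X -> R, [/\ measurable_fun setT V, forall x, 1 <= V x &
  exists c betaH betag alphag alphaH alphaV : R,
  [/\ [/\ 0 <= betaH <= 2^-1, 0 <= betag <= 2^-1, 0 <= alphag, 0 <= alphaH
        & 0 <= alphaV],
      drift_bound V xi c alphaH betaH,
      moment_bound V xi c alphaV,
      forall i t x, proj_set S 0 t ->
        (ereal_sup [set (enorm (g t' x) + enorm (kop t' (g t') x))%:E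
            | t' in proj_set S i]
          <= (c * xi i `^ alphag * V x `^ betag)%:E)%E &
      forall t x, proj_set S 0 t ->
      let E (Z : Om -> R) := ('E_(law S t x)[Z])%E in
      let Gam := gain S t x in
      [/\ (forall i, (1 <= i)%N ->
             measurable_fun setT (poisson_increment g t x i)) /\
          (\sum_(1 <= i <oo) (E (Gam i.+1) * (xi i `^ alphaw)%:E
              * E (poisson_increment g t x i)) < +oo)%E,
          (\sum_(1 <= i <oo) (E (fun om => (Gam i om ^+ 2)%R) *
              (xi i `^ (2 * alphaw + 2 * Num.max (alphaH + betaH * alphaV)
                                           (alphag + betag * alphaV)))%:E)
            < +oo)%E,
          (\sum_(1 <= i <oo) (E (fun om => (Gam i.+1 om * Gam i om)%R) *
              (xi i `^ (alphaH + alphag + (betaH + betag) * alphaV))%:E)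
            < +oo)%E &
          (\sum_(1 <= i <oo) (`|E (fun om => (Gam i.+1 om - Gam i om)%R)| *
              (xi i `^ (alphaw + alphag + betag * alphaV))%:E)
            < +oo)%E]]]].

End stochastic_approximation.

(* Main.v *)
Require Import Defs.
From HB Require Import structures.
From mathcomp Require Import all_boot all_order all_algebra.
From mathcomp Require Import all_classical all_reals all_analysis.
From mathcomp Require Import measurable_realfun.
From mathcomp Require Import ring lra.
Set Implicit Arguments.
Unset Strict Implicit.
Unset Printing Implicit Defensive.
Import Order.TTheory GRing.Theory Num.Theory.
Import numFieldNormedType.Exports.
Local Open Scope classical_set_scope.
Local Open Scope ring_scope.

(** Every estimate is made in the weighted sup norm of weight W = V^betaH, and
    coordinate by coordinate: a coordinate is bounded by the Euclidean norm, and
    the Euclidean norm by d times a common bound on the coordinates.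

    For one kernel, geometric ergodicity makes the series
      g_t = sum_k (P_t^k H(t, .) - h(t))
    converge to a solution of the Poisson equation that has mean zero under pi_t
    and is at most a constant times xi_i^alphaH W M_t / (1 - rho_t) when t is
    in R_i ([poisson_solE], [stat_poisson_sol], [dominated_poisson_sol]).  This is
    clause (iii) of (P), with alphag = alphaH + alphaM + alpharho and betag = betaH.

    The crux is clause (iv).  As pi_t does not depend on t, the difference
    u = g_t - g_t' has mean zero and satisfies
      u - P_t u = psi - pi psi,   psi = (H_t - H_t') + (P_t - P_t') g_t' .
    Iterating this equation writes u as the convergent series of the centred
    iterates of psi, so u is at most |psi| M_t / (1 - rho_t) in norm
    ([poisson_bound]), while condition (C) bounds psi by powers betaDelta and betaD
    of |t - t'| ([poisson_sol_perturbation]).  Along the process,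
      |theta_i - theta_(i-1)| <= Gamma_i |H(theta_(i-1), X_i)|
                              <= c0 c i^(-eta) xi_i^alphaH V^betaH(X_i),
    which leaves moments of V(X_i) of order betaH (1 + beta), with beta one of the
    two exponents.  This order is at most 1, so the moment is at most twice the same
    power of the bound on the first moment ([integral_powR_le]).  Multiplied by
    Gamma_(i+1) xi_i^alphaw these are, up to constants, the terms of the first two
    series of (e).

    The other clauses on the steps all reduce to the third series of (e), because
    Gamma_i^2, Gamma_(i+1) Gamma_i and Gamma_i - Gamma_(i+1) are all at most a
    constant times i^(-2 eta); for the difference this is where eta <= 1 enters
    ([powR_sub_le]).

    Two points are purely measure theoretic.  Real-valued integrals of functions
    that are not integrable are conventional numbers, so the integrability of W is
    extracted from (G) by truncation ([integrable_of_truncation]).  And the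
    kernels depend measurably on the parameter only for the trace sigma-algebra on
    Theta x X; composing with a measurable map into Theta, here theta_i itself,
    turns them into a kernel from Om x X to X, for which iterates, limits and hence
    the Poisson solution are jointly measurable ([measurable_poisson_sol]). *)

(** * Weighted sup-norm ergodicity and the Poisson equation *)

Section truncation.
Context {R : realType} {dT : measure_display} {T : measurableType dT}.
Implicit Types (mu : {measure set T -> \bar R}) (W : T -> R).

(** A bound on the real-valued integral of [W] itself would say nothing, as that integral
    is a conventional number when the extended one is infinite.  The truncations are
    bounded, hence integrable, and monotone convergence carries their bound over to [W]. *)
Lemma integrable_of_truncation mu W B : (mu setT < +oo)%E ->
  measurable_fun setT W -> (forall x, 0 <= W x) ->
  (forall n : nat, \int[mu]_x Num.min (W x) n%:R <= B) ->
  mu.-integrable setT (EFin \o W).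
Proof.
move=> muT mW W0 hB; apply/integrableP; split; first exact/measurable_EFinP.
have mtr n : measurable_fun setT (fun x => Num.min (W x) n%:R).
  by apply: measurable_minr => //; exact: measurable_cst.
have itr n : mu.-integrable setT (EFin \o (fun x => Num.min (W x) n%:R)).
  apply: measurable_bounded_integrable => //.
  exists n%:R; split => // z nz x _ /=.
  by rewrite ger0_norm ?le_min ?W0 ?ler0n// ge_min (ltW nz) orbT.
have cvg_tr x : (Num.min (W x) n%:R)%:E @[n --> \oo] --> (W x)%:E.
  apply: cvg_near_cst; near=> n.
  congr EFin; apply/min_idPl.
  near: n; exact: nbhs_infty_ger.
have mono : (\int[mu]_x (Num.min (W x) n%:R)%:E @[n --> \oo] -->
    \int[mu]_x (W x)%:E)%E.
  rewrite [X in _ --> X](_ : _ =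
      \int[mu]_x (limn (fun n => (Num.min (W x) n%:R)%:E)))%E; last first.
    by apply: eq_integral => x _; apply/esym/cvg_lim.
  apply: cvg_monotone_convergence => //.
  - by move=> n; exact/measurable_EFinP.
  - by move=> n x _; rewrite lee_fin le_min W0/=.
  - move=> x _ m n mn; rewrite lee_fin le_min ge_min lexx/= ge_min.
    by rewrite ler_nat mn orbT.
apply: (@le_lt_trans _ _ B%:E); last exact: ltry.
under eq_integral do rewrite /= ger0_norm//.
apply: cvge_le mono; apply: nearW => n.
by rewrite -(fineK (integrable_fin_num _ (itr n)))// lee_fin; exact: hB.
Unshelve. all: by end_near. Qed.

End truncation.

(** At [n = 0] the tail estimate bounds the sum of the series. *)
Lemma geometric_tail {R : realType} (a : nat -> R) (B rho : R) : 0 <= B -> 0 < rho < 1 ->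
  (forall k, `|a k| <= B * rho ^+ k) ->
  cvgn (series a) /\
  forall n, `|limn (series a) - series a n| <= B * rho ^+ n / (1 - rho).
Proof.
move=> B0 /andP[rho0 rho1] ha.
have nrho : `|rho| < 1 by rewrite ger0_norm// ltW.
have rho1' : 0 < 1 - rho by rewrite subr_gt0.
have cva : cvgn (series a).
  apply: normed_cvg; apply: (@series_le_cvg _ _ (geometric B rho)).
  - by move=> k /=.
  - by move=> k /=; rewrite mulr_ge0// exprn_ge0// ltW.
  - by move=> k /=; exact: ha.
  - exact: is_cvg_geometric_series.
split=> // n.
have tail m : `|series a (n + m)%N - series a n| <= B * rho ^+ n / (1 - rho).
  rewrite sub_series leq_addr -{1}[n]add0n big_addn addKn.
  apply: (le_trans (ler_norm_sum _ _ _)).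
  apply: (@le_trans _ _ (series (geometric (B * rho ^+ n) rho) m)).
    apply: ler_sum => k _; rewrite (le_trans (ha _))//= exprD mulrA mulrAC.
    by [].
  by rewrite geometric_le_lim// mulr_ge0// exprn_ge0// ltW.
have cvt : `|series a (n + m)%N - series a n| @[m --> \oo] -->
    `|limn (series a) - series a n|.
  apply: cvg_norm; apply: cvgB; last exact: cvg_cst.
  rewrite -(cvg_shiftn n) in cva *.
  by under eq_fun do rewrite addnC; exact: cva.
apply: (cvgr_to_le cvt); exact: nearW.
Qed.

Section ergodic_operator.
Context {R : realType} {dX : measure_display} {X : measurableType dX}.
Implicit Types (P : R.-pker X ~> X) (pi : probability X R) (phi psi u : X -> R).

Definition kint P phi : X -> R := fun x => \int[P x]_y phi y.

(** [C] bounds the sup norm of [phi / W], the scalar counterpart of [vnorm]. *)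
Definition dominated (W : X -> R) (C : R) phi :=
  measurable_fun setT phi /\ forall x, `|phi x| <= C * W x.

(** Geometric ergodicity of [P] towards [pi] in the weighted sup norm, the weight being
    part of the data since all later estimates are relative to it. *)
Definition geom_ergodic P pi (W : X -> R) (M rho : R) :=
  [/\ measurable_fun setT W, forall x, 1 <= W x, 0 <= M, 0 < rho < 1 &
  forall phi C, dominated W C phi -> forall k x,
    `|iter k (kint P) phi x - \int[pi]_y phi y| <= C * W x * (M * rho ^+ k)].

Section dominated_functions.
Variable W : X -> R.

Lemma dominated_ge0 C phi (x : X) : (forall y, 1 <= W y) ->
  dominated W C phi -> 0 <= C.
Proof.
move=> W1 [_ /(_ x) /(le_trans (normr_ge0 _))].
by rewrite pmulr_lge0// (lt_le_trans ltr01).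
Qed.

Lemma dominatedB C C' phi psi : dominated W C phi -> dominated W C' psi ->
  dominated W (C + C') (fun x => phi x - psi x).
Proof.
move=> [mf bf] [mg bg]; split; first exact: measurable_funB.
by move=> x; rewrite mulrDl (le_trans (ler_normB _ _))// lerD.
Qed.

Lemma dominatedD C C' phi psi : dominated W C phi -> dominated W C' psi ->
  dominated W (C + C') (fun x => phi x + psi x).
Proof.
move=> [mf bf] [mg bg]; split; first exact: measurable_funD.
by move=> x; rewrite mulrDl (le_trans (ler_normD _ _))// lerD.
Qed.

Lemma dominated_cst (a : R) : (forall y, 1 <= W y) -> dominated W `|a| (cst a).
Proof. by move=> W1; split => // x /=; rewrite ler_peMr. Qed.

End dominated_functions.

Lemma measurable_kint P phi : measurable_fun setT phi ->
  measurable_fun setT (kint P phi).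
Proof.
move=> mphi; rewrite /kint /Rintegral.
apply: measurableT_comp => //=.
under eq_fun do rewrite integralE.
apply: emeasurable_funB; apply: measurable_fun_integral_kernel => //.
- by move=> U mU; exact: measurable_kernel.
- by apply: measurable_funepos; exact/measurable_EFinP.
- by move=> U mU; exact: measurable_kernel.
- by apply: measurable_funeneg; exact/measurable_EFinP.
Qed.

Section geometric_ergodicity.
Context P pi (W : X -> R) (M rho : R).
Hypothesis ergP : geom_ergodic P pi W M rho.

Let mW : measurable_fun setT W. Proof. by case: ergP. Qed.
Let W1 x : 1 <= W x. Proof. by case: ergP. Qed.
Let W0 x : 0 <= W x. Proof. exact: le_trans (W1 x). Qed.
Let M0 : 0 <= M. Proof. by case: ergP. Qed.
Let rho01 : 0 < rho < 1. Proof. by case: ergP. Qed.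

Let erg phi C : dominated W C phi -> forall k x,
  `|iter k (kint P) phi x - \int[pi]_y phi y| <= C * W x * (M * rho ^+ k).
Proof. by case: ergP => _ _ _ _ e; exact: e. Qed.

Let rho0 : 0 <= rho.
Proof. by case/andP: rho01 => /ltW. Qed.

Let rho1 : 0 < 1 - rho.
Proof. by rewrite subr_gt0; case/andP: rho01. Qed.

Let weight_truncation n : dominated W 1 (fun x => Num.min (W x) n%:R).
Proof.
split; first by apply: measurable_minr => //; exact: measurable_cst.
move=> x; rewrite mul1r ger0_norm ?le_min ?W0 ?ler0n//.
by rewrite ge_min lexx.
Qed.

Let stat_weight_truncation (x : X) n :
  \int[pi]_y Num.min (W y) n%:R <= (1 + M) * W x.
Proof.
have := erg (weight_truncation n) 0 x.
rewrite /= expr0 mulr1 mul1r ler_norml => /andP[+ _].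
have : Num.min (W x) n%:R <= W x by rewrite ge_min lexx.
lra.
Qed.

Lemma integrable_stat_weight (x : X) : pi.-integrable setT (EFin \o W).
Proof.
apply: (integrable_of_truncation (B := (1 + M) * W x)) => //.
  exact: le_lt_trans (probability_le1 pi measurableT) (ltry _).
Qed.

(** The ergodicity estimates of orders 0 and 1 for the truncations of [W] compare
    their mean under [pi], resp. under [P x], with their value at [x], which is at most
    [W x] whatever the level of truncation. *)
Lemma integrable_kernel_weight x : (P x).-integrable setT (EFin \o W).
Proof.
apply: (integrable_of_truncation (B := (1 + M + M * rho) * W x)) => //.
  by rewrite prob_kernel ltry.
move=> n; have := erg (weight_truncation n) 1 x.
rewrite /= expr1 mul1r ler_norml => /andP[_].
have := stat_weight_truncation x n.
rewrite /kint; lra.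
Qed.

Let integrable_dominated (mu : {measure set X -> \bar R}) C phi :
  mu.-integrable setT (EFin \o W) -> dominated W C phi ->
  mu.-integrable setT (EFin \o phi).
Proof.
move=> iW [mphi bphi].
have iCW : mu.-integrable setT (fun x => (C * W x)%:E).
  by under eq_fun do rewrite EFinM; exact: integrableZl.
apply: le_integrable iCW => //; first exact/measurable_EFinP.
by move=> x _; rewrite /= lee_fin (le_trans (bphi x))// ler_norm.
Qed.

Lemma integrable_kernel C phi x : dominated W C phi ->
  (P x).-integrable setT (EFin \o phi).
Proof. exact/integrable_dominated/integrable_kernel_weight. Qed.

Lemma integrable_stat C phi (x : X) : dominated W C phi ->
  pi.-integrable setT (EFin \o phi).
Proof. exact/integrable_dominated/(integrable_stat_weight x). Qed.

Lemma kintB C C' phi psi : dominated W C phi -> dominated W C' psi ->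
  kint P (fun x => phi x - psi x) = (fun x => kint P phi x - kint P psi x).
Proof.
move=> dphi dpsi; apply/funext => x; rewrite /kint RintegralB//.
  exact: integrable_kernel dphi.
exact: integrable_kernel dpsi.
Qed.

Lemma kintD C C' phi psi : dominated W C phi -> dominated W C' psi ->
  kint P (fun x => phi x + psi x) = (fun x => kint P phi x + kint P psi x).
Proof.
move=> dphi dpsi; apply/funext => x; rewrite /kint RintegralD//.
  exact: integrable_kernel dphi.
exact: integrable_kernel dpsi.
Qed.

Lemma kint_cst (a : R) : kint P (cst a) = cst a.
Proof.
by apply/funext => x; rewrite /kint Rintegral_cst// prob_kernel/= mulr1.
Qed.

(** Going through the mean of [phi], with the ergodicity estimate of order [k] on one
    side and of order 0 on the other, gives a constant that does not grow with [k]. *)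
Lemma dominated_iter_kint C phi k : dominated W C phi ->
  dominated W (C * (2 * M + 1)) (iter k (kint P) phi).
Proof.
move=> dphi; split.
  by elim: k => [|k ih] /=; [case: dphi|exact: measurable_kint].
move=> x; have C0 := dominated_ge0 x W1 dphi.
have CW0 : 0 <= C * W x by rewrite mulr_ge0.
have := erg dphi k x; have := erg dphi 0 x; rewrite /= expr0 mulr1.
have : C * W x * (M * rho ^+ k) <= C * W x * M.
  rewrite ler_wpM2l// ler_piMr// exprn_ile1//.
  by case/andP: rho01 => _ /ltW.
have := dphi.2 x; rewrite !ler_norml.
move=> /andP[? ?] ? /andP[? ?] /andP[? ?].
have -> : C * (2 * M + 1) * W x = C * W x + 2 * (C * W x * M) by ring.
apply/andP; split; lra.
Qed.

Lemma dominated_kint C phi : dominated W C phi ->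
  dominated W (C * (2 * M + 1)) (kint P phi).
Proof. exact: (@dominated_iter_kint _ _ 1). Qed.

Lemma cvg_iter_kint C phi x : dominated W C phi ->
  iter n (kint P) phi x @[n --> \oo] --> \int[pi]_y phi y.
Proof.
move=> dphi; apply/subr_cvg0/norm_cvg0P.
apply: (@squeeze_cvgr _ _ _ _ (cst 0) (geometric (C * W x * M) rho)).
- apply: nearW => n /=; rewrite normr_ge0/= (le_trans (erg dphi n x))//.
  by rewrite mulrA.
- exact: cvg_cst.
- by apply: cvg_geometric; rewrite ger0_norm//; case/andP: rho01.
Qed.

(** Both sides are the limit of the iterates of [phi], since those of [kint P phi] are the
    same sequence shifted by one. *)
Lemma stat_kint C phi (x : X) : dominated W C phi ->
  \int[pi]_y kint P phi y = \int[pi]_y phi y.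
Proof.
move=> dphi; have := cvg_iter_kint x (dominated_kint dphi).
under eq_fun do rewrite -iterSr.
rewrite (cvg_shiftS (fun n => iter n (kint P) phi x)) => h.
exact: (cvg_unique _ h (cvg_iter_kint x dphi)).
Qed.

(** Applying [P] repeatedly to the equation expresses the difference of two successive
    iterates of [u] as a centred iterate of [psi]; the differences then telescope. *)
Lemma poisson_telescope C C' u psi n : dominated W C' u -> dominated W C psi ->
  (forall x, u x - kint P u x = psi x - \int[pi]_y psi y) ->
  forall x, u x = series (fun k => iter k (kint P) psi x - \int[pi]_y psi y) n
                  + iter n (kint P) u x.
Proof.
move=> du dpsi eq_u.
have step k : (fun x => iter k (kint P) u x - iter k.+1 (kint P) u x) =
    (fun x => iter k (kint P) psi x - cst (\int[pi]_y psi y) x).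
  elim: k => [|k ih]; first by apply/funext => x /=; exact: eq_u.
  have := congr1 (kint P) ih.
  rewrite (kintB (dominated_iter_kint k du) (dominated_iter_kint k.+1 du)).
  rewrite (kintB (dominated_iter_kint k dpsi) (dominated_cst _ W1)).
  by rewrite kint_cst.
move=> x; elim: n => [|n ih]; first by rewrite /series/= big_geq// add0r.
rewrite {1}ih [in RHS]/series/= big_nat_recr//= -addrA; congr +%R.
by have /= <- := congr1 (@^~ x) (step n); rewrite subrK.
Qed.

(** The remainder of the telescoping identity tends to the mean of [u], which is zero, so
    [u] is the sum of the centred iterates of [psi], a geometrically dominated series. *)
Lemma poisson_bound C C' u psi : dominated W C' u -> dominated W C psi ->
  (forall x, u x - kint P u x = psi x - \int[pi]_y psi y) ->
  \int[pi]_y u y = 0 ->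
  forall x, `|u x| <= C * (M / (1 - rho)) * W x.
Proof.
move=> du dpsi eq_u u0 x; have C0 := dominated_ge0 x W1 dpsi.
have B0 : 0 <= C * W x * M by rewrite !mulr_ge0.
have cv := cvg_iter_kint x du; rewrite u0 in cv.
have [cvs tail] := geometric_tail (a := fun k => iter k (kint P) psi x -
   \int[pi]_y psi y) B0 rho01 (fun k => (le_trans (erg dpsi k x) ltac:(by rewrite mulrA))).
have -> : u x = limn (series (fun k => iter k (kint P) psi x - \int[pi]_y psi y)).
  apply/esym/cvg_lim => //.
  rewrite [X in X @ _](_ : _ = (fun n => u x - iter n (kint P) u x)).
    by rewrite -[X in _ --> X]subr0; apply: cvgB => //; exact: cvg_cst.
  by apply/funext => n; rewrite {1}(poisson_telescope n du dpsi eq_u x) addrK.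
have := tail 0%N; rewrite {2}/series/= big_geq// subr0 expr0 mulr1 => /le_trans.
by apply; rewrite le_eqVlt; apply/orP; left; apply/eqP; ring.
Qed.

Definition poisson_sol phi x : R :=
  limn (series (fun k => iter k (kint P) phi x - \int[pi]_y phi y)).

Let partial phi n x := series (fun k => iter k (kint P) phi x - \int[pi]_y phi y) n.

Let poisson_sol_tail C phi n : dominated W C phi ->
  dominated W (C * M * rho ^+ n / (1 - rho))
    (fun x => poisson_sol phi x - partial phi n x).
Proof.
move=> dphi.
have tl x : cvgn (partial phi ^~ x) /\
    `|poisson_sol phi x - partial phi n x| <= C * M * rho ^+ n / (1 - rho) * W x.
  have C0 := dominated_ge0 x W1 dphi.
  have B0 : 0 <= C * W x * M by rewrite !mulr_ge0.
  have [cvs tail] := geometric_tail (a := fun k => iter k (kint P) phi x -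
    \int[pi]_y phi y) B0 rho01
      (fun k => (le_trans (erg dphi k x) ltac:(by rewrite mulrA))).
  split => //; rewrite (le_trans (tail n))//.
  by rewrite le_eqVlt; apply/orP; left; apply/eqP; ring.
have mpart m : measurable_fun setT (partial phi m).
  apply: measurable_sum => k; apply: measurable_funB; last exact: measurable_cst.
  by case: (dominated_iter_kint k dphi).
split; last by move=> x; case: (tl x).
apply: measurable_funB => //.
apply: (measurable_fun_cvg (h := partial phi)) => // x _.
by case: (tl x).
Qed.

Lemma dominated_poisson_sol C phi : dominated W C phi ->
  dominated W (C * (M / (1 - rho))) (poisson_sol phi).
Proof.
move=> /(poisson_sol_tail 0); rewrite expr0 mulr1 -mulrA.
rewrite (_ : (fun x => _) = poisson_sol phi)//; apply/funext => x.
by rewrite /partial /series/= big_geq// subr0.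
Qed.

Let dominated_partial C phi n : dominated W C phi ->
  dominated W (C * (M / (1 - rho)) + C * M * rho ^+ n / (1 - rho)) (partial phi n).
Proof.
move=> dphi.
have := dominatedB (dominated_poisson_sol dphi) (poisson_sol_tail n dphi).
move=> [m b]; split=> [|x].
  rewrite (_ : partial phi n = (fun x => poisson_sol phi x -
    (poisson_sol phi x - partial phi n x)))//.
  by apply/funext => x; rewrite subKr.
by have := b x; rewrite subKr.
Qed.

Lemma cvg_poisson_sol C phi x : dominated W C phi ->
  series (fun k => iter k (kint P) phi x - \int[pi]_y phi y) @ \oo
    --> poisson_sol phi x.
Proof.
move=> dphi; have C0 := dominated_ge0 x W1 dphi.
have B0 : 0 <= C * W x * M by rewrite !mulr_ge0.
by have [] := geometric_tail (a := fun k => iter k (kint P) phi x -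
  \int[pi]_y phi y) B0 rho01
    (fun k => (le_trans (erg dphi k x) ltac:(by rewrite mulrA))).
Qed.

Let kint_partial C phi n x : dominated W C phi ->
  kint P (partial phi n) x = partial phi n.+1 x - (phi x - \int[pi]_y phi y).
Proof.
move=> dphi; elim: n x => [|n ih] x.
  rewrite /partial /series/= big_nat1 subrr.
  rewrite (_ : (fun x => _) = cst 0) ?kint_cst//.
  by apply/funext => y; rewrite big_geq.
rewrite (_ : partial phi n.+1 = (fun y => partial phi n y +
   (iter n (kint P) phi y - cst (\int[pi]_y phi y) y))); last first.
  by apply/funext => y; rewrite /partial /series/= big_nat_recr.
rewrite (kintD (dominated_partial n dphi)
  (dominatedB (dominated_iter_kint n dphi) (dominated_cst _ W1))) ih.
rewrite (kintB (dominated_iter_kint n dphi) (dominated_cst _ W1)) kint_cst.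
rewrite [in RHS]/partial [in RHS]/series/= [in RHS]big_nat_recr//=.
rewrite /partial /series/=; lra.
Qed.

(** [P] sends the n-th partial sum of the series to the next one minus its first term.
    The remainders tend to zero in weighted norm and [P] is bounded for this norm, so the
    identity passes to the limit. *)
Lemma poisson_solE C phi x : dominated W C phi ->
  poisson_sol phi x - kint P (poisson_sol phi) x = phi x - \int[pi]_y phi y.
Proof.
move=> dphi.
have dsol := dominated_poisson_sol dphi.
have rem n : kint P (fun y => poisson_sol phi y - partial phi n y) x =
    kint P (poisson_sol phi) x - partial phi n.+1 x + (phi x - \int[pi]_y phi y).
  by rewrite (kintB dsol (dominated_partial n dphi)) (kint_partial _ _ dphi); ring.
have cv0 : kint P (fun y => poisson_sol phi y - partial phi n y) x @[n --> \oo]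
    --> 0.
  apply/norm_cvg0P.
  apply: (@squeeze_cvgr _ _ _ _ (cst 0)
    (geometric (C * M / (1 - rho) * (2 * M + 1) * W x) rho)).
  - apply: nearW => n /=; rewrite normr_ge0/=.
    have [_ /(_ x)] := dominated_kint (poisson_sol_tail n dphi).
    by move/le_trans; apply; rewrite le_eqVlt; apply/orP; left; apply/eqP; ring.
  - exact: cvg_cst.
  - by apply: cvg_geometric; rewrite ger0_norm//; case/andP: rho01.
have cvp : partial phi n.+1 x @[n --> \oo] --> poisson_sol phi x.
  by rewrite (cvg_shiftS (partial phi ^~ x)); exact: cvg_poisson_sol dphi.
have cv1 : kint P (poisson_sol phi) x - partial phi n.+1 x +
    (phi x - \int[pi]_y phi y) @[n --> \oo] -->
    kint P (poisson_sol phi) x - poisson_sol phi x + (phi x - \int[pi]_y phi y).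
  by apply: cvgD; [apply: cvgB => //; exact: cvg_cst|exact: cvg_cst].
rewrite (funext rem) in cv0.
have h : 0 = kint P (poisson_sol phi) x - poisson_sol phi x +
    (phi x - \int[pi]_y phi y) by exact: cvg_unique _ cv0 cv1.
lra.
Qed.

(** By the telescoping identity the iterates of the solution are the remainders of its own
    series; they tend to zero, but also to the mean of the solution. *)
Lemma stat_poisson_sol C phi (x : X) : dominated W C phi ->
  \int[pi]_y poisson_sol phi y = 0.
Proof.
move=> dphi; have dsol := dominated_poisson_sol dphi.
have cv := cvg_iter_kint x dsol.
have cv0 : iter n (kint P) (poisson_sol phi) x @[n --> \oo] --> 0.
  rewrite [X in X @ _](_ : _ = (fun n => poisson_sol phi x - partial phi n x)).
    rewrite -(subrr (poisson_sol phi x)).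
    by apply: cvgB; [exact: cvg_cst|exact: cvg_poisson_sol dphi].
  apply/funext => n.
  rewrite (poisson_telescope n dsol dphi (fun y => poisson_solE y dphi) x).
  by rewrite addrAC subrr add0r.
exact: cvg_unique _ cv cv0.
Qed.

End geometric_ergodicity.

End ergodic_operator.

(** * Measurability in a parameter of the kernel *)

Section Rintegral_kernel.
Context {R : realType} {dT dX : measure_display} {T : measurableType dT}
  {X : measurableType dX}.
Implicit Types F : T -> X -> R.

(** The integrand varies with [u] as well, so the positive and negative parts are
    integrated as functions on the product, against [l] made into a finite kernel. *)
Lemma measurable_Rintegral_kernel (l : T -> {measure set X -> \bar R}) F :
  (forall A, measurable A -> measurable_fun setT (l ^~ A)) ->
  (forall u, l u setT = 1%E) ->
  measurable_fun setT (fun z : T * X => F z.1 z.2) ->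
  measurable_fun setT (fun u => \int[l u]_y F u y).
Proof.
move=> ml l1 mF.
pose kl := @isKernel.Build _ _ T X R l ml.
pose K0 : R.-ker T ~> X := HB.pack l kl.
pose pl := @Kernel_isProbability.Build _ _ T X R K0 l1.
pose K : R.-pker T ~> X := HB.pack l kl pl.
have mI (k : T * X -> \bar R) : (forall z, 0 <= k z)%E ->
    measurable_fun setT k -> measurable_fun setT (fun u => \int[l u]_y k (u, y))%E.
  move=> k0 mk.
  exact: (@measurable_fun_integral_finite_kernel _ _ _ _ _ k K k0 mk).
rewrite /Rintegral; apply: measurableT_comp => //=.
under eq_fun do rewrite integralE.
have mFE : measurable_fun setT (fun z : T * X => (F z.1 z.2)%:E).
  exact/measurable_EFinP.
pose FE z : \bar R := (F z.1 z.2)%:E.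
apply: emeasurable_funB.
  rewrite (_ : (fun u => _) = (fun u => \int[l u]_y FE^\+ (u, y)))%E.
    by apply: mI => //; exact: measurable_funepos mFE.
  by apply/funext => u; apply: eq_integral => y _; rewrite !funeposE.
rewrite (_ : (fun u => _) = (fun u => \int[l u]_y FE^\- (u, y)))%E.
  by apply: mI => //; exact: measurable_funeneg mFE.
by apply/funext => u; apply: eq_integral => y _; rewrite !funenegE.
Qed.

End Rintegral_kernel.

Section joint_measurability.
Context {R : realType} {dT dX : measure_display} {T : measurableType dT}
  {X : measurableType dX}.
Implicit Types F : T -> X -> R.
Variable K : T -> R.-pker X ~> X.
Hypothesis mK : forall A, measurable A ->
  measurable_fun setT (fun z : T * X => K z.1 z.2 A).

(** A family of kernels indexed by [T] is one kernel from [T * X] to [X], and each iteration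
    is an integral against it of a function of the parameter and of the new point. *)
Lemma measurable_iter_kint F k :
  measurable_fun setT (fun z : T * X => F z.1 z.2) ->
  measurable_fun setT (fun z : T * X => iter k (kint (K z.1)) (F z.1) z.2).
Proof.
move=> mF; elim: k => [//|k ih] /=; rewrite {1}/kint.
apply: (@measurable_Rintegral_kernel _ _ _ _ X (fun z : T * X => K z.1 z.2)
  (fun z y => iter k (kint (K z.1)) (F z.1) y)) => //.
  by move=> z; exact: prob_kernel.
have mproj : measurable_fun setT (fun w : T * X * X => (w.1.1, w.2)).
  apply: measurable_fun_pair; last exact: measurable_snd.
  by apply: (measurableT_comp measurable_fst); exact: measurable_fst.
exact: (measurableT_comp ih mproj).
Qed.

(** The mean of [F u] under [pi u] is also a limit of iterates, so that its measurability
    in [u] comes from that of the kernels. *)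
Lemma measurable_poisson_sol (pi : T -> probability X R) (W : X -> R)
    (M rho C : T -> R) F :
  (forall u, geom_ergodic (K u) (pi u) W (M u) (rho u)) ->
  (forall u, dominated W (C u) (F u)) ->
  measurable_fun setT (fun z : T * X => F z.1 z.2) ->
  measurable_fun setT (fun z : T * X => poisson_sol (K z.1) (pi z.1) (F z.1) z.2).
Proof.
move=> erg dF mF.
have mpi : measurable_fun setT (fun z : T * X => \int[pi z.1]_y F z.1 y).
  apply: (measurable_fun_cvg (h := fun k (z : T * X) =>
    iter k (kint (K z.1)) (F z.1) z.2)).
    by move=> k; exact: measurable_iter_kint.
  by move=> z _; exact: (cvg_iter_kint (erg z.1) z.2 (dF z.1)).
apply: (measurable_fun_cvg (h := fun n (z : T * X) => series (fun k =>
  iter k (kint (K z.1)) (F z.1) z.2 - \int[pi z.1]_y F z.1 y) n)).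
  move=> n; apply: measurable_sum => k; apply: measurable_funB => //.
  exact: measurable_iter_kint.
by move=> z _; exact: (cvg_poisson_sol (erg z.1) (x := z.2) (dF z.1)).
Qed.

End joint_measurability.

(** * Dependence of the Poisson solution on the kernel *)

Section perturbation.
Context {R : realType} {dX : measure_display} {X : measurableType dX}.
Implicit Types (W phi : X -> R).

(** The equation gives [P g] as [g] minus the centred [phi]; each of the three resulting
    terms is at most [C * (M / (1 - rho)) * W], the centred [phi] because [M <= M / (1 - rho)]. *)
Lemma poisson_sol_bound (P : R.-pker X ~> X) (pi : probability X R) M rho W C phi :
  geom_ergodic P pi W M rho -> dominated W C phi ->
  forall x, `|poisson_sol P pi phi x| + `|kint P (poisson_sol P pi phi) x|
    <= 3 * C * (M / (1 - rho)) * W x.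
Proof.
move=> erg dphi x; have [mW W1 M0 rho01 ergb] := erg.
have W0 : 0 <= W x by exact: le_trans (W1 x).
have C0 := dominated_ge0 x W1 dphi.
have rho1 : 0 < 1 - rho by rewrite subr_gt0; case/andP: rho01.
have MN : M <= M / (1 - rho).
  by rewrite ler_peMr// invf_ge1// lerBlDr lerDl; case/andP: rho01 => /ltW.
have [_ /(_ x) b1] := dominated_poisson_sol erg dphi.
have b2 := ergb _ _ dphi 0 x; rewrite /= expr0 mulr1 in b2.
have eqn := poisson_solE erg x dphi.
have -> : kint P (poisson_sol P pi phi) x =
    poisson_sol P pi phi x - (phi x - \int[pi]_y phi y) by lra.
have b3 := ler_normB (poisson_sol P pi phi x) (phi x - \int[pi]_y phi y).
have b4 : C * W x * M <= C * W x * (M / (1 - rho)) by rewrite ler_wpM2l// mulr_ge0.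
nra.
Qed.

(** The two solutions solve Poisson equations for different kernels.  Rewriting the second
    one for [P] adds [(P - P') g'] to the right-hand side; as the means agree, the
    difference of the solutions is then the mean-zero solution of a single Poisson equation
    for [P], to which [poisson_bound] applies.  The factor 2 pays for passing from the
    solutions to their images under the kernels. *)
Lemma poisson_sol_perturbation (P P' : R.-pker X ~> X) (pi pi' : probability X R)
    M M' rho rho' W C delta eps phi phi' :
  geom_ergodic P pi W M rho -> geom_ergodic P' pi' W M' rho' ->
  (forall psi, \int[pi']_y psi y = \int[pi]_y psi y) ->
  0 <= delta -> 0 <= eps ->
  dominated W C phi -> dominated W C phi' ->
  (forall x, `|phi x - phi' x| <= delta * W x) ->
  (forall psi B, dominated W B psi ->
     forall x, `|kint P psi x - kint P' psi x| <= B * eps * W x) ->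
  forall x, `|kint P (poisson_sol P pi phi) x - kint P' (poisson_sol P' pi' phi') x|
    <= 2 * (delta + C * (M' / (1 - rho')) * eps) * (M / (1 - rho)) * W x.
Proof.
move=> erg erg' eqpi delta0 eps0 dphi dphi' hdelta heps x.
have [mW W1 M0 rho01 ergb] := erg; have [_ _ M'0 rho'01 _] := erg'.
set g := poisson_sol P pi phi; set g' := poisson_sol P' pi' phi'.
have W0 : 0 <= W x by exact: le_trans (W1 x).
have C0 := dominated_ge0 x W1 dphi.
have dg : dominated W _ g := dominated_poisson_sol erg dphi.
have dg' : dominated W _ g' := dominated_poisson_sol erg' dphi'.
have rho1 : 0 < 1 - rho by rewrite subr_gt0; case/andP: rho01.
have rho'1 : 0 < 1 - rho' by rewrite subr_gt0; case/andP: rho'01.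
have dPg' := dominated_kint erg dg'.
have dP'g' := dominated_kint erg' dg'.
pose v y := kint P g' y - kint P' g' y.
have dv : dominated W (C * (M' / (1 - rho')) * eps) v.
  split; first by apply: measurable_funB; [exact: dPg'.1|exact: dP'g'.1].
  exact: heps.
have ddphi : dominated W delta (fun y => phi y - phi' y).
  by split => //; apply: measurable_funB; [exact: dphi.1|exact: dphi'.1].
pose psi y := (phi y - phi' y) + v y.
have dpsi := dominatedD ddphi dv.
have iS B f : dominated W B f -> pi.-integrable setT (EFin \o f).
  exact: integrable_stat erg _ _ x.
(* Invariance: both images of [g'] have the mean of [g']. *)
have pi_v : \int[pi]_y v y = 0.
  rewrite RintegralB//; [|exact: iS dPg'|exact: iS dP'g'].
  rewrite (stat_kint erg x dg') -!eqpi.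
  by rewrite (stat_kint erg' x dg') subrr.
have pi_psi : \int[pi]_y psi y = \int[pi]_y phi y - \int[pi]_y phi' y.
  rewrite RintegralD//; [|exact: iS ddphi|exact: iS dv].
  by rewrite pi_v addr0 RintegralB//; [exact: iS dphi|exact: iS dphi'].
pose u y := g y - g' y.
have du : dominated W _ u := dominatedB dg dg'.
have eq_u y : u y - kint P u y = psi y - \int[pi]_z psi z.
  rewrite pi_psi (kintB erg dg dg').
  have := poisson_solE erg y dphi.
  have := poisson_solE erg' y dphi'.
  by rewrite eqpi /u /psi /v -/g -/g' => h h'; lra.
have pi_u : \int[pi]_y u y = 0.
  rewrite RintegralB//; [|exact: iS dg|exact: iS dg'].
  rewrite (stat_poisson_sol erg x dphi) -eqpi.
  by rewrite (stat_poisson_sol erg' x dphi') subrr.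
have bu := poisson_bound erg du dpsi eq_u pi_u x.
have bphi := ergb _ _ ddphi 0 x; rewrite /= expr0 mulr1 in bphi.
rewrite RintegralB// in bphi; [|exact: iS dphi|exact: iS dphi'].
have -> : kint P g x - kint P' g' x =
    u x - (phi x - phi' x - (\int[pi]_y phi y - \int[pi]_y phi' y)).
  have := poisson_solE erg x dphi.
  have := poisson_solE erg' x dphi'.
  by rewrite eqpi /u -/g -/g' => h h'; lra.
rewrite (le_trans (ler_normB _ _))//.
have MN : M <= M / (1 - rho).
  by rewrite ler_peMr// invf_ge1// lerBlDr lerDl; case/andP: rho01 => /ltW.
have b4 : delta * W x * M <= delta * W x * (M / (1 - rho)).
  by rewrite ler_wpM2l// mulr_ge0.
have b5 : 0 <= C * (M' / (1 - rho')) * eps * (M / (1 - rho)) * W x.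
  by rewrite !mulr_ge0 ?invr_ge0 ?(ltW rho1) ?(ltW rho'1).
set N := M / (1 - rho) in b4 b5 bu *; set e := C * _ * eps in b5 bu *.
rewrite (le_trans (lerD bu (le_trans bphi b4)))//.
rewrite -subr_ge0 [X in 0 <= X](_ : _ = e * N * W x)//; ring.
Qed.

End perturbation.

(** * The Euclidean norm and the Borel sets of row vectors *)

Section euclidean_norm.
Context {R : realType} {d : nat}.
Implicit Types u : 'rV[R]_d.

Lemma enorm_ge0 u : 0 <= enorm u.
Proof. exact: sqrtr_ge0. Qed.

Lemma coordB u v j : (u - v) ord0 j = u ord0 j - v ord0 j.
Proof. by rewrite !mxE. Qed.

Lemma normr_le_enorm u j : `|u ord0 j| <= enorm u.
Proof.
rewrite -sqrtr_sqr ler_wsqrtr// /dotp (bigD1 j)//= -expr2 lerDl.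
by apply: sumr_ge0 => k _; rewrite -expr2 sqr_ge0.
Qed.

Lemma enorm_le_sum u : enorm u <= \sum_(j < d) `|u ord0 j|.
Proof.
have S0 : 0 <= \sum_(j < d) `|u ord0 j| by exact: sumr_ge0.
rewrite -[leRHS]ger0_norm// -sqrtr_sqr ler_wsqrtr// expr2 mulr_suml.
apply: ler_sum => j _; rewrite -expr2 -real_normK ?num_real// expr2 ler_wpM2l//.
by rewrite (bigD1 j)//= lerDl sumr_ge0.
Qed.

Lemma enorm_le_cst u (B : R) : (forall j, `|u ord0 j| <= B) -> enorm u <= d%:R * B.
Proof.
move=> uB; apply: (le_trans (enorm_le_sum u)).
by rewrite (le_trans (ler_sum _ (fun j _ => uB j)))// sumr_const card_ord mulr_natl.
Qed.

Lemma enormZ (a : R) u : enorm (a *: u) = `|a| * enorm u.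
Proof.
rewrite /enorm (_ : dotp (a *: u) (a *: u) = a ^+ 2 * dotp u u).
  by rewrite sqrtrM ?sqr_ge0// sqrtr_sqr.
by rewrite /dotp mulr_sumr; apply: eq_bigr => j _; rewrite !mxE; ring.
Qed.

Lemma enorm_delta (j : 'I_d) : enorm (delta_mx 0 j : 'rV[R]_d) = 1.
Proof.
rewrite /enorm /dotp (bigD1 j)//= big1 => [|k kj].
  by rewrite !mxE !eqxx/= mulr1 addr0 sqrtr1.
by rewrite !mxE (negbTE kj) andbF mul0r.
Qed.

Lemma measurable_coord j : measurable_fun setT (fun u => u ord0 j).
Proof.
move=> _ B mB; rewrite setTI.
apply: sub_sigma_algebra => /=.
rewrite -bigcup_seq/=; exists j; first by rewrite /= mem_index_enum.
by exists B => //; rewrite setTI.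
Qed.

(** The Borel sets of row vectors are generated by the coordinates. *)
Lemma measurable_row {dT} {T : measurableType dT} (f : T -> 'rV[R]_d) :
  (forall j, measurable_fun setT (fun x => f x ord0 j)) -> measurable_fun setT f.
Proof.
move=> mf.
apply: (measurability (\big[setU/set0]_(j < d)
  preimage_set_system setT (fun u : 'rV[R]_d => u ord0 j) measurable)) => //.
rewrite -bigcup_seq => _ [_ [j _ [B mB <-]] <-].
by rewrite [X in f @^-1` X]setTI; exact: mf.
Qed.

Lemma measurable_enorm {dT} {T : measurableType dT} (f : T -> 'rV[R]_d) :
  (forall j, measurable_fun setT (fun x => f x ord0 j)) ->
  measurable_fun setT (fun x => enorm (f x)).
Proof.
move=> mf.
have msqrt : measurable_fun setT (@Num.sqrt R).
  by apply: continuous_measurable_fun; exact: sqrt_continuous.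
apply: (measurableT_comp msqrt).
by apply: measurable_sum => j; exact: measurable_funM.
Qed.

End euclidean_norm.

(** * Step sizes, series and moments *)

Section real_estimates.
Context {R : realType}.

(** With [q = i / i.+1] the difference is [i ^ (- eta) * (1 - q ^ eta)].  Since [eta <= 1],
    the second factor is at most [1 - q], which is the inverse of [i.+1] and hence at
    most [i ^ (- eta)]. *)
Lemma powR_sub_le (eta : R) (i : nat) : 0 < eta <= 1 -> (1 <= i)%N ->
  0 <= i%:R `^ (- eta) - i.+1%:R `^ (- eta) <= i%:R `^ (- (2 * eta)).
Proof.
move=> /andP[eta0 eta1] i1.
have i0 : 0 < i%:R :> R by rewrite ltr0n.
have ge1 : 1 <= i%:R :> R by rewrite ler1n.
have iS0 : 0 < i.+1%:R :> R by rewrite ltr0n.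
set q : R := i%:R / i.+1%:R.
have q01 : 0 < q <= 1.
  by rewrite /q divr_gt0//= ler_pdivrMr// mul1r ler_nat.
have -> : i.+1%:R `^ (- eta) = i%:R `^ (- eta) * q `^ eta.
  rewrite /q powRM ?ltW// ?invr_gt0// !powRN.
  rewrite mulrA mulVf ?gt_eqF ?powR_gt0// mul1r.
  by rewrite -[i.+1%:R^-1]powR_inv1 ?ltW// -powRrM mulN1r powRN.
have q1 : q `^ eta <= 1.
  by rewrite -[leRHS](powRr0 q) ger_powR ?q01// ltW.
have qq : q <= q `^ eta by rewrite ger1_powR.
rewrite -{1 3}[i%:R `^ (- eta)]mulr1 -mulrBr mulr_ge0 ?powR_ge0 ?subr_ge0//=.
have -> : - (2 * eta) = - eta + - eta by ring.
rewrite powRD; last by rewrite (gt_eqF i0) implybT.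
rewrite ler_wpM2l ?powR_ge0//.
rewrite (@le_trans _ _ (1 - q))//; first by rewrite lerB.
have -> : 1 - q = i.+1%:R^-1.
  by rewrite /q -(natr1 i); field; rewrite natr1 gt_eqF.
rewrite (@le_trans _ _ (i%:R `^ (-1)))//.
  by rewrite powR_inv1 ?(ltW i0)// lef_pV2 ?posrE// ler_nat.
by rewrite ler_powR// lerN2.
Qed.

Lemma nneseries_dominated (a : nat -> \bar R) (b : nat -> R) (K : R) : 0 <= K ->
  (forall i, (1 <= i)%N -> (0 <= a i <= (K * b i)%:E)%E) ->
  (forall i, 0 <= b i) ->
  (\sum_(1 <= i <oo) (b i)%:E < +oo)%E ->
  (\sum_(1 <= i <oo) a i < +oo)%E.
Proof.
move=> K0 ab b0 sb; apply: (@le_lt_trans _ _ (\sum_(1 <= i <oo) (K * b i)%:E)%E).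
  rewrite [leLHS]eseries_cond [leRHS]eseries_cond.
  by apply: lee_nneseries => [i _|i] /andP[_ /ab /andP[]].
under eq_eseriesr do rewrite EFinM.
rewrite nneseriesZl => [|i _]; last by rewrite lee_fin.
by rewrite lte_mul_pinfty// lee_fin.
Qed.

(** Pointwise [f ^ s <= a ^ s * (1 + f / a)]: the first term covers [f <= a], the second
    [f > a].  Integrating gives Jensen's inequality up to the factor 2. *)
Lemma integral_powR_le {dT} {T : measurableType dT} (mu : probability T R)
    (f : T -> R) (a s : R) :
  measurable_fun setT f -> (forall x, 0 <= f x) -> 0 < a -> 0 <= s <= 1 ->
  (\int[mu]_x (f x)%:E <= a%:E)%E ->
  (\int[mu]_x (f x `^ s)%:E <= (2 * a `^ s)%:E)%E.
Proof.
move=> mf f0 a0 /andP[s0 s1] fa.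
have key x : f x `^ s <= a `^ s + a `^ s / a * f x.
  have as0 : 0 <= a `^ s by exact: powR_ge0.
  have [fxa|afx] := leP (f x) a.
    rewrite (@le_trans _ _ (a `^ s))//.
      by apply: ge0_ler_powR => //; rewrite nnegrE// ltW.
    by rewrite lerDl !mulr_ge0// invr_ge0 ltW.
  have -> : f x `^ s = a `^ s * (f x / a) `^ s.
    by rewrite -powRM ?divr_ge0 ?(ltW a0)// mulrCA divff ?mulr1// gt_eqF.
  have : (f x / a) `^ s <= f x / a.
    by rewrite ler1_powR// ler_pdivlMr// mul1r ltW.
  move=> /(ler_wpM2l as0) h; rewrite (le_trans h)//.
  by rewrite mulrA (mulrAC _ (f x)) lerDr.
apply: (@le_trans _ _ (\int[mu]_x ((a `^ s)%:E + (a `^ s / a)%:E * (f x)%:E))%E).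
  apply: ge0_le_integral => //.
  - by move=> x _; rewrite lee_fin powR_ge0.
  - by apply/measurable_EFinP; exact: (measurableT_comp (measurable_powR s) mf).
  - apply: emeasurable_funD => //; apply: emeasurable_funM => //.
    exact/measurable_EFinP.
  - by move=> x _; rewrite -EFinM -EFinD lee_fin.
have c0 : 0 <= a `^ s / a by rewrite divr_ge0 ?powR_ge0 ?ltW.
have mfE : measurable_fun setT (EFin \o f) by exact/measurable_EFinP.
rewrite ge0_integralD//; first last.
- by apply: emeasurable_funM.
- by move=> x _; rewrite mule_ge0 ?lee_fin.
- by move=> x _; rewrite lee_fin powR_ge0.
have -> : (\int[mu]_x (a `^ s)%:E = (a `^ s)%:E)%E.
  rewrite integral_cst// [X in (_ * X)%E](_ : _ = 1%E) ?mule1//.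
  exact: probability_setT.
rewrite ge0_integralZl//; last by move=> x _; rewrite lee_fin.
apply: (@le_trans _ _ ((a `^ s)%:E + (a `^ s / a)%:E * a%:E)%E).
  by rewrite leeD2l// lee_wpmul2l// lee_fin.
by rewrite -EFinM -EFinD lee_fin divfK ?gt_eqF// mulrDl mul1r.
Qed.

End real_estimates.

(** * Passing from vector-valued conditions to coordinates *)

Lemma ereal_sup_image_le {R : realType} {T : Type} (A : set T) (f : T -> R) (B : R) :
  (ereal_sup [set (f t)%:E | t in A] <= B%:E)%E -> forall t, A t -> f t <= B.
Proof.
move=> h t At; rewrite -lee_fin; apply: le_trans h.
by apply: ereal_sup_ubound; exists t.
Qed.

Section weighted_norm.
Context {R : realType} {d : nat} {dX : measure_display} {X : measurableType dX}.
Variables (V : X -> R) (V1 : forall x, 1 <= V x).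
Implicit Types f : X -> 'rV[R]_d.

Lemma powR_weight_gt0 r x : 0 < V x `^ r.
Proof. by rewrite powR_gt0// (lt_le_trans ltr01). Qed.

Lemma vnorm_le r f (C : R) : (forall x, enorm (f x) <= C * V x `^ r) ->
  (vnorm V r f <= C%:E)%E.
Proof.
move=> fC; apply: ge_ereal_sup => _ [x _ <-].
by rewrite lee_fin ler_pdivrMr ?powR_weight_gt0.
Qed.

Lemma le_vnorm r f (C : R) : (vnorm V r f <= C%:E)%E ->
  forall x, enorm (f x) <= C * V x `^ r.
Proof.
move=> fC x; rewrite -ler_pdivrMr ?powR_weight_gt0// -lee_fin.
by apply: le_trans fC; apply: ereal_sup_ubound; exists x.
Qed.

End weighted_norm.

Section scheme_operators.
Context {R : realType} {d : nat} {dX : measure_display} {X : measurableType dX}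
  {dO : measure_display} {Om : measurableType dO} (S : scheme R d X Om).
Context (V : X -> R) (mV : measurable_fun setT V) (V1 : forall x, 1 <= V x).
Implicit Types (t : 'rV[R]_d) (f : X -> 'rV[R]_d) (phi : X -> R).

Lemma kop_coord t f x j :
  kop S t f x ord0 j = kint (kern S t) (fun y => f y ord0 j) x.
Proof. by rewrite mxE. Qed.

Lemma iter_kop_coord t f k j :
  (fun x => iter k (kop S t) f x ord0 j) =
  iter k (kint (kern S t)) (fun x => f x ord0 j).
Proof.
elim: k => [//|k ih] /=; apply/funext => x.
by rewrite kop_coord -ih.
Qed.

Let lift_coord (j : 'I_d) phi : X -> 'rV[R]_d := fun x => phi x *: delta_mx 0 j.

Let lift_coordE j phi : (fun x => lift_coord j phi x ord0 j) = phi.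
Proof. by apply/funext => x; rewrite !mxE !eqxx mulr1. Qed.

Let lift_coord_dominated j phi r C : dominated (fun x => V x `^ r) C phi ->
  measurable_fun setT (lift_coord j phi) /\ (vnorm V r (lift_coord j phi) <= C%:E)%E.
Proof.
move=> [mphi bphi]; split.
  apply: measurable_row => k.
  rewrite (_ : (fun x => _) = (fun x => phi x * (delta_mx 0 j : 'rV[R]_d) ord0 k)).
    by apply: measurable_funM => //; exact: measurable_cst.
  by apply/funext => x; rewrite mxE.
by apply: vnorm_le => // x; rewrite enormZ enorm_delta mulr1.
Qed.

(** A scalar function is tested by placing it in one coordinate of a vector-valued one,
    which preserves the weighted norm.  The index [j] only witnesses that there is a
    coordinate. *)
Lemma coord_geom_ergodic (j : 'I_d) t r (M rho : R) : 0 <= M -> 0 < rho < 1 ->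
  0 <= r ->
  (forall f, measurable_fun setT f -> (vnorm V r f < +oo)%E -> forall k x,
    ((enorm (iter k (kop S t) f x - vint (stat S t) f))%:E
      <= (V x `^ r)%:E * vnorm V r f * (M * rho ^+ k)%:E)%E) ->
  geom_ergodic (kern S t) (stat S t) (fun x => V x `^ r) M rho.
Proof.
move=> M0 rho01 r0 erg; split => //.
- exact: (measurableT_comp (measurable_powR r) mV).
- by move=> x; rewrite -(powRr0 (V x)) ler_powR.
move=> phi C dphi k x; have [mf fC] := lift_coord_dominated j dphi.
have := erg _ mf (le_lt_trans fC (ltry _)) k x.
have -> : (`|iter k (kint (kern S t)) phi x - \int[stat S t]_y phi y| =
    `|(iter k (kop S t) (lift_coord j phi) x - vint (stat S t) (lift_coord j phi))
       ord0 j|)%R.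
  rewrite coordB [vint _ _ _ _]mxE.
  have /(congr1 (@^~ x)) /= -> := iter_kop_coord t (lift_coord j phi) k j.
  by rewrite lift_coordE.
move=> h; apply: (le_trans (normr_le_enorm _ j)); rewrite -lee_fin.
apply: (le_trans h); rewrite (mulrC C) !EFinM.
by rewrite lee_wpmul2r// ?lee_wpmul2l// lee_fin ?powR_ge0// mulr_ge0// exprn_ge0//;
  case/andP: rho01 => /ltW.
Qed.

Lemma coord_kernel_continuity (j : 'I_d) t t' r (E : R) : 0 <= E ->
  (forall f, measurable_fun setT f -> (vnorm V r f < +oo)%E ->
    (vnorm V r (fun x => (kop S t f x - kop S t' f x)%R) <= vnorm V r f * E%:E)%E) ->
  forall phi C, dominated (fun x => V x `^ r) C phi ->
  forall x, `|kint (kern S t) phi x - kint (kern S t') phi x| <= C * E * V x `^ r.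
Proof.
move=> E0 cont phi C dphi x; have [mf fC] := lift_coord_dominated j dphi.
have cE : (vnorm V r (fun x => kop S t (lift_coord j phi) x -
    kop S t' (lift_coord j phi) x)%R <= (C * E)%:E)%E.
  apply: (le_trans (cont _ mf (le_lt_trans fC (ltry _)))).
  by rewrite EFinM lee_wpmul2r// lee_fin.
have /(_ x) := le_vnorm V1 cE; apply: le_trans.
apply: le_trans (normr_le_enorm _ j).
by rewrite coordB !kop_coord lift_coordE.
Qed.

End scheme_operators.

(** * The process with expanding projections *)

(** A trace measurable set and its measurable extension have the same preimage under a map
    that takes its values in [D]. *)
Lemma trace_measurable_comp {d1 d2 d3} {T : measurableType d1}
    {U : measurableType d2} {Y : measurableType d3} (D : set U) (f : U -> Y) (p : T -> U) :
  trace_measurable_fun D f -> measurable_fun setT p -> (forall u, D (p u)) ->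
  measurable_fun setT (f \o p).
Proof.
move=> mf mp pD _ B mB; rewrite setTI.
have [C mC eC] := mf B mB.
rewrite (_ : _ @^-1` _ = p @^-1` C).
  by rewrite -[X in measurable X]setTI; exact: mp.
apply/seteqP; split => u /= h.
  by have : (D `&` f @^-1` B) (p u) by []; rewrite eC => -[].
by have : (D `&` C) (p u) by []; rewrite -eC => -[].
Qed.

Section expanding_projections.
Context {R : realType} {d : nat} {dX : measure_display} {X : measurableType dX}
  {dO : measure_display} {Om : measurableType dO} (S : scheme R d X Om).
Context (hset : setting S)
  (hproc : forall t x, proj_set S 0 t -> process_from S t x)
  (hR : forall i, proj_set S i `<=` proj_set S i.+1)
  (hTheta : hatTheta S `<=` Theta S).
Implicit Types (t : 'rV[R]_d) (x : X) (i : nat) (j : 'I_d).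

Lemma proj_set_hatTheta i t : proj_set S i t -> hatTheta S t.
Proof. by move=> Rt; exists i. Qed.

Lemma proj_set_le i k : (i <= k)%N -> proj_set S i `<=` proj_set S k.
Proof.
move=> /subnK <-; elim: (k - i)%N => [//|n ih] t /ih; exact: hR.
Qed.

Lemma param_proj_set t x i om : proj_set S 0 t -> proj_set S i (param S t x i om).
Proof.
move=> R0; have [p0 _ _ pS pp] := hproc x R0.
case: i => [|i]; first by rewrite (p0 om).1.
rewrite pS; case: ifPn => [/set_mem//|_]; exact: (pp i).1.
Qed.

Lemma measurable_drift_coord {dT} {T : measurableType dT} (p : T -> 'rV[R]_d)
    (q : T -> X) j :
  measurable_fun setT p -> measurable_fun setT q -> (forall u, hatTheta S (p u)) ->
  measurable_fun setT (fun u => drift S (p u) (q u) ord0 j).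
Proof.
move=> mp mq hp; have [_ mH _ _] := hset.
have mpq : measurable_fun setT (fun u => (p u, q u)) by exact: measurable_fun_pair.
have mHpq := trace_measurable_comp mH mpq (fun u => conj (hTheta (hp u)) Logic.I).
exact: (measurableT_comp (measurable_coord j) mHpq).
Qed.

Lemma measurable_kern {dT} {T : measurableType dT} (p : T -> 'rV[R]_d)
    (q : T -> X) A : measurable A ->
  measurable_fun setT p -> measurable_fun setT q -> (forall u, hatTheta S (p u)) ->
  measurable_fun setT (fun u => kern S (p u) (q u) A).
Proof.
move=> mA mp mq hp; have [_ _ mP _] := hset.
have mpq : measurable_fun setT (fun u => (p u, q u)) by exact: measurable_fun_pair.
exact: trace_measurable_comp (mP _ mA) mpq (fun u => conj (hTheta (hp u)) Logic.I).
Qed.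

(** The candidate for the solutions g_theta of condition (P). *)
Definition poisson_field t : X -> 'rV[R]_d := fun x =>
  \row_j poisson_sol (kern S t) (stat S t) (fun y => drift S t y ord0 j) x.

Lemma poisson_field_coord t j :
  (fun x => poisson_field t x ord0 j) =
  poisson_sol (kern S t) (stat S t) (fun y => drift S t y ord0 j).
Proof. by apply/funext => x; rewrite mxE. Qed.

Lemma kop_poisson_field t x j : kop S t (poisson_field t) x ord0 j =
  kint (kern S t) (poisson_sol (kern S t) (stat S t)
    (fun y => drift S t y ord0 j)) x.
Proof. by rewrite kop_coord poisson_field_coord. Qed.

Context (V : X -> R) (xi : nat -> R) (c betaH alphaH : R).
Context (mV : measurable_fun setT V) (V1 : forall x, 1 <= V x)
  (xi1 : forall i, 1 <= xi i) (hdrift : drift_bound S V xi c alphaH betaH).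

Let W x := V x `^ betaH.

Lemma drift_le i t x : proj_set S i t ->
  enorm (drift S t x) <= c * xi i `^ alphaH * W x.
Proof.
have [[_ [t0 R0]] _ _ _] := hset => Rt.
exact: (ereal_sup_image_le (hdrift i x R0) Rt).
Qed.

Lemma dominated_drift i t j : proj_set S i t ->
  dominated W (c * xi i `^ alphaH) (fun x => drift S t x ord0 j).
Proof.
move=> Rt; split; last by move=> x; exact: le_trans (normr_le_enorm _ _) (drift_le x Rt).
apply: (measurable_drift_coord (p := fun _ => t) (q := id)) => // _.
exact: proj_set_hatTheta Rt.
Qed.

(** The point [x] witnesses that the weighted norms are taken over a nonempty set. *)
Lemma drift_cst_ge0 x : 0 <= c.
Proof.
have [[_ [t R0]] _ _ _] := hset.
have := le_trans (enorm_ge0 _) (drift_le x R0).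
by rewrite !pmulr_lge0 ?powR_weight_gt0.
Qed.

(* In dimension 0 the scalar consequences of (G) and (C) are not available; the index
   [j] in [erg] and [hD] restricts them to the dimensions where they are used. *)
Context (M rho : 'rV[R]_d -> R) (alphaM alpharho cG : R).
Context (cG0 : 0 <= cG)
  (erg : forall j t, hatTheta S t -> geom_ergodic (kern S t) (stat S t) W (M t) (rho t))
  (Mle : forall i t, proj_set S i t -> M t <= cG * xi i `^ alphaM)
  (rhole : forall i t, proj_set S i t -> (1 - rho t)^-1 <= cG * xi i `^ alpharho).

Lemma poisson_cst_le i j t : proj_set S i t ->
  M t / (1 - rho t) <= cG ^+ 2 * xi i `^ (alphaM + alpharho).
Proof.
move=> Rt; have [_ _ M0 /andP[_ rho1] _] := erg j (proj_set_hatTheta Rt).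
have -> : cG ^+ 2 * xi i `^ (alphaM + alpharho) =
    (cG * xi i `^ alphaM) * (cG * xi i `^ alpharho).
  rewrite powRD; last by rewrite (gt_eqF (lt_le_trans ltr01 (xi1 i))) implybT.
  by ring.
by rewrite ler_pM ?invr_ge0 ?subr_ge0 ?(ltW rho1) ?Mle ?rhole.
Qed.

Lemma poisson_field_solution t : hatTheta S t ->
  poisson_solution S t (poisson_field t).
Proof.
move=> hT; have [i _ Rt] := hT; split.
- apply: measurable_row => j; rewrite poisson_field_coord.
  by have [] := dominated_poisson_sol (erg j hT) (dominated_drift j Rt).
- move=> x j.
  have := integrable_kernel (erg j hT) x
    (dominated_poisson_sol (erg j hT) (dominated_drift j Rt)).
  by rewrite -poisson_field_coord.
- move=> x; apply/rowP => j.
  rewrite [LHS]coordB [RHS]coordB kop_poisson_field [mean_field _ _ _ _]mxE.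
  rewrite [poisson_field _ _ _ _]mxE.
  exact: (poisson_solE (erg j hT) x (dominated_drift j Rt)).
Qed.

Lemma poisson_field_le i t x : proj_set S i t ->
  enorm (poisson_field t x) + enorm (kop S t (poisson_field t) x) <=
  6 * d%:R * c * cG ^+ 2 * xi i `^ (alphaH + alphaM + alpharho) * W x.
Proof.
move=> Rt; have hT := proj_set_hatTheta Rt.
set B := 3 * (c * xi i `^ alphaH) * (cG ^+ 2 * xi i `^ (alphaM + alpharho)) * W x.
have key j : `|poisson_field t x ord0 j| + `|kop S t (poisson_field t) x ord0 j| <= B.
  rewrite kop_poisson_field [poisson_field _ _ _ _]mxE.
  apply: (le_trans (poisson_sol_bound (erg j hT) (dominated_drift j Rt) x)).
  rewrite /B ler_wpM2r ?powR_ge0// ler_wpM2l ?(poisson_cst_le j Rt)//.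
  by rewrite !mulr_ge0 ?powR_ge0 ?(drift_cst_ge0 x).
have -> : 6 * d%:R * c * cG ^+ 2 * xi i `^ (alphaH + alphaM + alpharho) * W x =
    d%:R * B + d%:R * B.
  have -> : xi i `^ (alphaH + alphaM + alpharho) =
      xi i `^ alphaH * xi i `^ (alphaM + alpharho).
    rewrite -powRD ?addrA//.
    by rewrite (gt_eqF (lt_le_trans ltr01 (xi1 i))) implybT.
  by rewrite /B; ring.
apply: lerD; apply: enorm_le_cst => j; apply: le_trans (key j).
  by rewrite lerDl.
by rewrite lerDr.
Qed.

Context (D : 'rV[R]_d -> 'rV[R]_d -> R)
  (cD alphaD betaD cDelta alphaDelta betaDelta : R).
Context (hstat : forall t t', hatTheta S t -> hatTheta S t' ->
    forall A, measurable A -> stat S t A = stat S t' A)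
  (D0 : forall t t', hatTheta S t -> hatTheta S t' -> 0 <= D t t')
  (hD : forall j t t', hatTheta S t -> hatTheta S t' -> forall phi C,
    dominated W C phi -> forall x, `|kint (kern S t) phi x - kint (kern S t') phi x|
      <= C * (D t t' * enorm (t - t') `^ betaD) * W x)
  (Dle : forall i t t', proj_set S i t -> proj_set S i t' ->
    D t t' <= cD * xi i `^ alphaD)
  (hDelta : forall i t t', proj_set S i t -> proj_set S i t' -> forall x,
    enorm (drift S t x - drift S t' x) <=
    cDelta * xi i `^ alphaDelta * enorm (t - t') `^ betaDelta * W x).

(** The scalar perturbation estimate has [delta] of order
    [xi ^ alphaDelta * |t - t'| ^ betaDelta], [eps] of order
    [xi ^ alphaD * |t - t'| ^ betaD], and a factor [M / (1 - rho)] of order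
    [xi ^ (alphaM + alpharho)].  The norm of the second solution, which multiplies [eps],
    brings in that order once more, and the order [xi ^ alphaH] of the drift. *)
Lemma kop_poisson_field_perturbation : exists2 K, 0 <= K & forall i t t' x,
  proj_set S i t -> proj_set S i t' ->
  enorm (kop S t (poisson_field t) x - kop S t' (poisson_field t') x) <=
  K * (xi i `^ (alphaM + alpharho + alphaDelta) * enorm (t - t') `^ betaDelta
     + xi i `^ (2 * alphaM + 2 * alpharho + alphaD + alphaH)
       * enorm (t - t') `^ betaD) * W x.
Proof.
pose K1 := 2 * `|cDelta| * cG ^+ 2; pose K2 := 2 * `|c| * cG ^+ 4 * `|cD|.
have K10 : 0 <= K1 by rewrite !mulr_ge0 ?exprn_ge0.
have K20 : 0 <= K2 by rewrite !mulr_ge0 ?exprn_ge0.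
exists (d%:R * (K1 + K2)); first by rewrite mulr_ge0 ?addr_ge0.
move=> i t t' x Rt Rt'.
have hT := proj_set_hatTheta Rt; have hT' := proj_set_hatTheta Rt'.
have xi0 : xi i != 0 by rewrite (gt_eqF (lt_le_trans ltr01 (xi1 i))).
have xiD a b : xi i `^ (a + b) = xi i `^ a * xi i `^ b.
  by rewrite powRD// xi0 implybT.
have c0 := drift_cst_ge0 x.
set b1 := enorm (t - t') `^ betaDelta; set b2 := enorm (t - t') `^ betaD.
have b10 : 0 <= b1 by exact: powR_ge0.
have b20 : 0 <= b2 by exact: powR_ge0.
set Z1 := xi i `^ (alphaM + alpharho + alphaDelta).
set Z2 := xi i `^ (2 * alphaM + 2 * alpharho + alphaD + alphaH).
have Z10 : 0 <= Z1 by exact: powR_ge0.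
have Z20 : 0 <= Z2 by exact: powR_ge0.
rewrite -!mulrA; apply: enorm_le_cst => j; rewrite coordB !kop_poisson_field.
have delta0 : 0 <= `|cDelta| * xi i `^ alphaDelta * b1.
  by rewrite !mulr_ge0 ?powR_ge0.
have eps0 : 0 <= D t t' * b2 by rewrite mulr_ge0// D0.
have eqpi psi : \int[stat S t']_y psi y = \int[stat S t]_y psi y.
  by congr fine; apply: eq_measure_integral => A mA _; exact: hstat.
have hdelta y : `|drift S t y ord0 j - drift S t' y ord0 j| <=
    `|cDelta| * xi i `^ alphaDelta * b1 * W y.
  rewrite -coordB (le_trans (normr_le_enorm _ _))//.
  rewrite (le_trans (hDelta Rt Rt' y))//.
  by rewrite !ler_wpM2r ?powR_ge0// ler_norm.
have := poisson_sol_perturbation (erg j hT) (erg j hT') eqpi delta0 eps0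
  (dominated_drift j Rt) (dominated_drift j Rt') hdelta (hD j hT hT') x.
move/le_trans; apply; rewrite [leRHS]mulrA ler_wpM2r ?powR_ge0//.
have N0 u : hatTheta S u -> 0 <= M u / (1 - rho u).
  move=> /(erg j)[_ _ M0 /andP[_ rho1] _].
  by rewrite divr_ge0// subr_ge0 ltW.
have N := poisson_cst_le j Rt; have N' := poisson_cst_le j Rt'.
have DD : D t t' <= `|cD| * xi i `^ alphaD.
  by rewrite (le_trans (Dle Rt Rt'))// ler_wpM2r ?powR_ge0// ler_norm.
set a := cG ^+ 2 * _ in N N'.
have a0 : 0 <= a by rewrite mulr_ge0 ?exprn_ge0 ?powR_ge0.
apply: (@le_trans _ _ (2 * (`|cDelta| * xi i `^ alphaDelta * b1 +
    c * xi i `^ alphaH * a * (`|cD| * xi i `^ alphaD * b2)) * a)).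
  have ca : 0 <= c * xi i `^ alphaH * (M t' / (1 - rho t')).
    by rewrite mulr_ge0 ?N0// mulr_ge0// powR_ge0.
  apply: ler_pM => //; [|exact: N0|].
    by rewrite mulr_ge0// addr_ge0// mulr_ge0.
  rewrite ler_wpM2l// lerD2l ler_pM//.
  - by rewrite ler_wpM2l// mulr_ge0 ?powR_ge0.
  - by rewrite ler_wpM2r.
have -> : 2 * (`|cDelta| * xi i `^ alphaDelta * b1 +
    c * xi i `^ alphaH * a * (`|cD| * xi i `^ alphaD * b2)) * a =
    K1 * (Z1 * b1) + K2 * (Z2 * b2).
  rewrite /K1 /K2 /Z1 /Z2 /a (ger0_norm c0) !mulr_natl !mulr2n !xiD; ring.
rewrite mulrDr !mulrDl -addrA lerD2l.
by rewrite (addrC (K2 * (Z1 * b1))) -addrA [leRHS]addrC -addrA lerDl addr_ge0 ?mulr_ge0.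
Qed.

Lemma measurable_kop_poisson_field {dT} {T : measurableType dT}
    (p : T -> 'rV[R]_d) (q : T -> X) i j :
  measurable_fun setT p -> measurable_fun setT q ->
  (forall u, proj_set S i (p u)) ->
  measurable_fun setT (fun u => kop S (p u) (poisson_field (p u)) (q u) ord0 j).
Proof.
move=> mp mq Rp; have hp u : hatTheta S (p u) := proj_set_hatTheta (Rp u).
have mp1 : measurable_fun setT (fun z : T * X => p z.1).
  exact: measurableT_comp.
have mK A : measurable A ->
    measurable_fun setT (fun z : T * X => kern S (p z.1) z.2 A).
  by move=> mA; apply: (measurable_kern mA mp1 measurable_snd) => z; exact: hp.
have mg : measurable_fun setT (fun z : T * X => poisson_sol (kern S (p z.1))
    (stat S (p z.1)) (fun y => drift S (p z.1) y ord0 j) z.2).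
  have ergp u : geom_ergodic (kern S (p u)) (stat S (p u)) W (M (p u)) (rho (p u)).
    exact: erg.
  have domp u : dominated W (c * xi i `^ alphaH) (fun y => drift S (p u) y ord0 j).
    exact: dominated_drift.
  have mdrift := measurable_drift_coord j mp1 measurable_snd (fun z => hp z.1).
  exact: (measurable_poisson_sol (K := fun u => kern S (p u)) mK ergp domp mdrift).
have := measurable_iter_kint (K := fun u => kern S (p u)) mK 1 (F := fun u => poisson_sol (kern S (p u))
  (stat S (p u)) (fun y => drift S (p u) y ord0 j)) mg.
have mq' : measurable_fun setT (fun u => (u, q u)) by exact: measurable_fun_pair.
move=> /measurableT_comp /(_ mq'); apply: eq_measurable_fun => u _ /=.
by rewrite kop_poisson_field.
Qed.

Lemma measurable_poisson_increment t x i : proj_set S 0 t -> (1 <= i)%N ->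
  measurable_fun setT (poisson_increment S poisson_field t x i).
Proof.
move=> R0 i1; have [_ [mp mq _] _ _ _] := hproc x R0.
apply: measurable_enorm => j; under eq_fun do rewrite coordB.
apply: measurable_funB.
  apply: (measurable_kop_poisson_field (i := i)) => // om.
  exact: param_proj_set.
apply: (measurable_kop_poisson_field (i := i.-1)) => // om.
exact: param_proj_set.
Qed.

Context (c0 eta : R) (alphaV : R).
Context (c00 : 0 <= c0)
  (hgain : forall t x i om, proj_set S 0 t -> (1 <= i)%N ->
    gain S t x i om = c0 * i%:R `^ (- eta))
  (hmoment : moment_bound S V xi c alphaV)
  (hd : forall t x i, proj_set S 0 t ->
     {ae law S t x, forall om,
       enorm (param S t x i.+1 om - param S t x i om)
       <= enorm (param_star S t x i.+1 om - param S t x i om)}).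

(** By the assumption on the projections the displacement is at most that of the
    unprojected step, namely the gain times the drift at [theta_(i-1)], a point of the
    previous, hence also of the current, projection set. *)
Lemma param_displacement t x i : proj_set S 0 t -> (1 <= i)%N ->
  {ae law S t x, forall om,
    enorm (param S t x i om - param S t x i.-1 om) <=
    c0 * i%:R `^ (- eta) * (c * xi i `^ alphaH) * W (chain S t x i om)}.
Proof.
case: i => // i R0 _; apply: filterS (hd x i R0) => om /le_trans; apply.
rewrite /param_star/= addrAC subrr add0r enormZ hgain//.
rewrite ger0_norm ?mulr_ge0 ?powR_ge0// -[leRHS]mulrA ler_wpM2l//.
  by rewrite mulr_ge0 ?powR_ge0.
apply: drift_le; exact: (hR (param_proj_set _ _ _ R0)).
Qed.

(** The constant is [c + 1], and not [c], for the bound on the first moment to be positive. *)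
Lemma moment_powR_le t x i s : proj_set S 0 t -> 0 <= s <= 1 ->
  (\int[law S t x]_om (V (chain S t x i om) `^ s)%:E <=
   (2 * ((c + 1) * V x) `^ s * xi i `^ (alphaV * s))%:E)%E.
Proof.
move=> R0 s01; have c_ge0 := drift_cst_ge0 x.
have V0 y : 0 < V y by rewrite (lt_le_trans ltr01).
have [_ [_ mq _] _ _ _] := hproc x R0.
have cV0 : 0 < (c + 1) * V x by rewrite mulr_gt0// ltr_wpDl.
have xiV0 : 0 < xi i `^ alphaV by rewrite powR_gt0// (lt_le_trans ltr01).
have EV : (\int[law S t x]_om (V (chain S t x i om))%:E <=
    ((c + 1) * V x * xi i `^ alphaV)%:E)%E.
  have := hmoment i x R0; rewrite unlock => /le_trans; apply.
  by rewrite lee_fin mulrAC ler_wpM2r ?(ltW xiV0)// ler_wpM2r ?(ltW (V0 x))// lerDl.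
have := integral_powR_le (measurableT_comp mV (mq i)) (fun om => ltW (V0 _))
  (mulr_gt0 cV0 xiV0) s01 EV.
by rewrite (@powRM _ _ (xi i `^ alphaV)) ?(ltW cV0) ?(ltW xiV0)// -powRrM mulrA.
Qed.

(** The displacement carries a factor [V ^ betaH], so the integrand is of order
    [V ^ (betaH * (1 + beta))], a power at most 1 of [V], whose moments are controlled. *)
Lemma expected_displacement t x beta : proj_set S 0 t ->
  0 < beta -> 0 <= betaH -> betaH * (1 + beta) <= 1 ->
  exists2 K, 0 <= K & forall i, (1 <= i)%N ->
  (\int[law S t x]_om (W (chain S t x i om) *
      enorm (param S t x i om - param S t x i.-1 om) `^ beta)%:E <=
   (K * (i%:R `^ (- (eta * beta)) *
     xi i `^ (alphaH * beta + alphaV * (betaH * (1 + beta)))))%:E)%E.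
Proof.
move=> R0 beta0 betaH0 hbeta; have c_ge0 := drift_cst_ge0 x.
have V0 y : 0 < V y by rewrite (lt_le_trans ltr01).
have [_ [mp mq _] _ _ _] := hproc x R0.
set s := betaH * (1 + beta) in hbeta *.
have s0 : 0 <= s by rewrite mulr_ge0// addr_ge0// ltW.
pose K := (c0 * c) `^ beta * (2 * ((c + 1) * V x) `^ s).
exists K; first by rewrite !mulr_ge0 ?powR_ge0.
move=> i i1.
have xi0 : 0 < xi i by rewrite (lt_le_trans ltr01).
pose B := c0 * i%:R `^ (- eta) * (c * xi i `^ alphaH).
have B0 : 0 <= B by rewrite !mulr_ge0 ?powR_ge0.
have mVs : measurable_fun setT (fun om => V (chain S t x i om) `^ s).
  exact: (measurableT_comp (measurable_powR s) (measurableT_comp mV (mq i))).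
have mW' : measurable_fun setT (fun om => W (chain S t x i om)).
  exact: (measurableT_comp (measurable_powR betaH) (measurableT_comp mV (mq i))).
have mdisp : measurable_fun setT (fun om =>
    enorm (param S t x i om - param S t x i.-1 om)).
  apply: measurable_enorm => j; under eq_fun do rewrite coordB.
  by apply: measurable_funB; exact: (measurableT_comp (measurable_coord j) (mp _)).
apply: (@le_trans _ _ (\int[law S t x]_om
    (B `^ beta * V (chain S t x i om) `^ s)%:E)%E).
  apply: ae_ge0_le_integral => //.
  - by move=> om _; rewrite lee_fin mulr_ge0 ?powR_ge0.
  - apply/measurable_EFinP; apply: measurable_funM => //.
    exact: (measurableT_comp (measurable_powR beta) mdisp).
  - by move=> om _; rewrite lee_fin mulr_ge0 ?powR_ge0.
  - by apply/measurable_EFinP; apply: measurable_funM.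
  apply: filterS (param_displacement x R0 i1) => om hom _.
  rewrite lee_fin.
  have -> : B `^ beta * V (chain S t x i om) `^ s =
      W (chain S t x i om) * (B * W (chain S t x i om)) `^ beta.
    rewrite powRM ?powR_ge0// /W -powRrM /s mulrDr mulr1 powRD.
      by rewrite mulrCA.
    by rewrite (gt_eqF (V0 _)) implybT.
  rewrite ler_wpM2l ?powR_ge0//.
  by apply: ge0_ler_powR; rewrite ?nnegrE ?enorm_ge0 ?mulr_ge0 ?powR_ge0 ?(ltW beta0).
under eq_integral do rewrite EFinM.
rewrite ge0_integralZl//; first last.
- by rewrite lee_fin powR_ge0.
- by move=> om _; rewrite lee_fin powR_ge0.
- exact/measurable_EFinP.
apply: (@le_trans _ _ ((B `^ beta)%:E *
    (2 * ((c + 1) * V x) `^ s * xi i `^ (alphaV * s))%:E)%E).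
  rewrite lee_wpmul2l ?lee_fin ?powR_ge0// moment_powR_le//.
  by rewrite s0.
rewrite -EFinM lee_fin /K.
have -> : B `^ beta = (c0 * c) `^ beta * (i%:R `^ (- (eta * beta)) * xi i `^ (alphaH * beta)).
  rewrite /B (_ : _ * _ * _ = c0 * c * (i%:R `^ (- eta) * xi i `^ alphaH)).
    rewrite (@powRM _ (c0 * c)) ?mulr_ge0 ?powR_ge0//.
    by rewrite (@powRM _ (i%:R `^ _)) ?powR_ge0// -!powRrM mulNr.
  by ring.
rewrite powRD; last by rewrite (gt_eqF xi0) implybT.
rewrite le_eqVlt; apply/orP; left; apply/eqP; ring.
Qed.

Lemma expected_poisson_increment t x : proj_set S 0 t -> 0 <= betaH ->
  0 < betaD -> betaH * (1 + betaD) <= 1 ->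
  0 < betaDelta -> betaH * (1 + betaDelta) <= 1 ->
  exists2 K, 0 <= K & forall i, (1 <= i)%N ->
  (\int[law S t x]_om (poisson_increment S poisson_field t x i om)%:E <=
   (K * (xi i `^ (alphaM + alpharho + alphaDelta) * (i%:R `^ (- (eta * betaDelta)) *
      xi i `^ (alphaH * betaDelta + alphaV * (betaH * (1 + betaDelta))))
    + xi i `^ (2 * alphaM + 2 * alpharho + alphaD + alphaH) *
      (i%:R `^ (- (eta * betaD)) *
      xi i `^ (alphaH * betaD + alphaV * (betaH * (1 + betaD))))))%:E)%E.
Proof.
move=> R0 betaH0 betaD0 hbetaD betaDelta0 hbetaDelta.
have [_ [mp mq _] _ _ _] := hproc x R0.
have [K0 K00 incr] := kop_poisson_field_perturbation.
have [K1 K10 E1] := expected_displacement x R0 betaDelta0 betaH0 hbetaDelta.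
have [K2 K20 E2] := expected_displacement x R0 betaD0 betaH0 hbetaD.
exists (K0 * (K1 + K2)); first by rewrite mulr_ge0 ?addr_ge0.
move=> i i1; move/(_ i i1) : E1; move/(_ i i1) : E2.
set e2 := (X in (K2 * X)%:E); set e1 := (X in (K1 * X)%:E) => E2 E1.
set Z1 := xi i `^ (alphaM + _ + _); set Z2 := xi i `^ (2 * alphaM + _ + _ + _).
have Z10 : 0 <= Z1 by exact: powR_ge0.
have Z20 : 0 <= Z2 by exact: powR_ge0.
have e10 : 0 <= e1 by rewrite mulr_ge0 ?powR_ge0.
have e20 : 0 <= e2 by rewrite mulr_ge0 ?powR_ge0.
pose disp om := enorm (param S t x i om - param S t x i.-1 om).
have mdisp : measurable_fun setT disp.
  apply: measurable_enorm => j; under eq_fun do rewrite coordB.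
  by apply: measurable_funB; exact: (measurableT_comp (measurable_coord j) (mp _)).
have mWd b : measurable_fun setT
    (fun om => (W (chain S t x i om) * disp om `^ b)%:E).
  apply/measurable_EFinP; apply: measurable_funM.
    exact: (measurableT_comp (measurable_powR betaH) (measurableT_comp mV (mq i))).
  exact: (measurableT_comp (measurable_powR b) mdisp).
have Wd0 b om : (0 <= (W (chain S t x i om) * disp om `^ b)%:E)%E.
  by rewrite lee_fin mulr_ge0 ?powR_ge0.
have KZ10 : (0 <= (K0 * Z1)%:E)%E by rewrite lee_fin mulr_ge0.
have KZ20 : (0 <= (K0 * Z2)%:E)%E by rewrite lee_fin mulr_ge0.
apply: (@le_trans _ _ (\int[law S t x]_om
   ((K0 * Z1)%:E * (W (chain S t x i om) * disp om `^ betaDelta)%:E +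
    (K0 * Z2)%:E * (W (chain S t x i om) * disp om `^ betaD)%:E))%E).
  apply: ge0_le_integral => //.
  - by move=> om _; rewrite lee_fin enorm_ge0.
  - by apply/measurable_EFinP; exact: measurable_poisson_increment.
  - by apply: emeasurable_funD; apply: emeasurable_funM.
  move=> om _; rewrite -!EFinM -EFinD lee_fin.
  have Ri := param_proj_set x i om R0.
  have Ri1 := proj_set_le (leq_pred i) (param_proj_set x i.-1 om R0).
  apply: (le_trans (incr i _ _ (chain S t x i om) Ri Ri1)).
  by rewrite le_eqVlt; apply/orP; left; apply/eqP; rewrite /disp /W /Z1 /Z2; ring.
rewrite ge0_integralD//; first last.
- by apply: emeasurable_funM.
- by move=> om _; rewrite mule_ge0.
- by apply: emeasurable_funM.
- by move=> om _; rewrite mule_ge0.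
rewrite !ge0_integralZl//.
apply: (@le_trans _ _ ((K0 * Z1)%:E * (K1 * e1)%:E + (K0 * Z2)%:E * (K2 * e2)%:E)%E).
  by apply: leeD; exact: lee_wpmul2l.
rewrite -!EFinM -EFinD lee_fin -/e1 -/e2 -subr_ge0.
rewrite [X in 0 <= X](_ : _ = K0 * (K2 * (Z1 * e1) + K1 * (Z2 * e2))); last by ring.
by apply: mulr_ge0 => //; apply: addr_ge0; do 2 apply: mulr_ge0 => //.
Qed.

Lemma expectation_gain t x i : proj_set S 0 t -> (1 <= i)%N ->
  ('E_(law S t x)[gain S t x i] = (c0 * i%:R `^ (- eta))%:E)%E.
Proof.
move=> R0 i1; rewrite (_ : gain S t x i = cst (c0 * i%:R `^ (- eta))).
  exact: expectation_cst.
by apply/funext => om; exact: hgain.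
Qed.

(** Once [i.+1] is replaced by [i] in the gain, the exponents of the [betaDelta] term add
    up exactly to those of the second given series, and those of the [betaD] term to at
    most those of the first one, as [betaH * alphaV <= alphaV]. *)
Lemma summable_poisson_increment t x alphaw : proj_set S 0 t ->
  0 < eta <= 1 -> 0 <= betaH <= 1 -> 0 <= alphaV ->
  0 < betaD -> betaH * (1 + betaD) <= 1 ->
  0 < betaDelta -> betaH * (1 + betaDelta) <= 1 ->
  (\sum_(1 <= i <oo) (i%:R `^ (- ((1 + betaD) * eta))
     * xi i `^ (alphaw + 2 * alphaM + 2 * alpharho + alphaD
                + (betaD + 1) * (betaH + alphaV + alphaH)))%:E < +oo)%E ->
  (\sum_(1 <= i <oo) (i%:R `^ (- ((1 + betaDelta) * eta))
     * xi i `^ (alphaw + alphaM + alpharho + alphaDelta + betaDelta * alphaH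
                + (betaDelta + 1) * betaH * alphaV))%:E < +oo)%E ->
  (\sum_(1 <= i <oo) ('E_(law S t x)[gain S t x i.+1] * (xi i `^ alphaw)%:E *
     'E_(law S t x)[poisson_increment S poisson_field t x i]) < +oo)%E.
Proof.
move=> R0 eta01 /andP[betaH0 betaH1] alphaV0 betaD0 hbetaD betaDelta0 hbetaDelta.
set f1 := (X in (\sum_(1 <= i <oo) X i)%E) => s1.
set f2 := (X in (\sum_(1 <= i <oo) X i)%E) => s2.
have [K K0 E_incr] := expected_poisson_increment x R0 betaH0 betaD0 hbetaD
  betaDelta0 hbetaDelta.
pose b i := fine (f1 i) + fine (f2 i).
apply: (@nneseries_dominated _ _ b (c0 * K)); first by rewrite mulr_ge0.
- move=> i i1; rewrite (expectation_gain _ R0)// expectation.unlock.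
  have i0 : 0 < i%:R :> R by rewrite ltr0n.
  have xi0 : 0 < xi i by rewrite (lt_le_trans ltr01).
  have xiD a a' : xi i `^ (a + a') = xi i `^ a * xi i `^ a'.
    by rewrite powRD// (gt_eqF xi0) implybT.
  have iD a a' : i%:R `^ (a + a') = i%:R `^ a * i%:R `^ a' :> R.
    by rewrite powRD// (gt_eqF i0) implybT.
  have incr0 : (0 <= \int[law S t x]_om
      (poisson_increment S poisson_field t x i om)%:E)%E.
    by apply: integral_ge0 => om _; rewrite lee_fin enorm_ge0.
  apply/andP; split; first by rewrite !mule_ge0// lee_fin ?mulr_ge0 ?powR_ge0.
  have [] := andP (powR_sub_le eta01 i1); rewrite subr_ge0 => gain_le _.
  have gw0 : 0 <= c0 * i.+1%:R `^ (- eta) * xi i `^ alphaw.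
    by rewrite !mulr_ge0 ?powR_ge0.
  rewrite -EFinM; apply: le_trans.
    apply: lee_wpmul2l; last exact: E_incr i1.
    by rewrite lee_fin.
  rewrite -EFinM lee_fin.
  set e := (X in K * X).
  have e0 : 0 <= e by rewrite addr_ge0// !mulr_ge0 ?powR_ge0.
  apply: (@le_trans _ _ (c0 * K * (i%:R `^ (- eta) * xi i `^ alphaw * e))).
    rewrite [leLHS](_ : _ = c0 * K * (i.+1%:R `^ (- eta) * xi i `^ alphaw * e)).
      by rewrite ler_wpM2l ?mulr_ge0// ler_wpM2r// ler_wpM2r ?powR_ge0.
    by ring.
  rewrite ler_wpM2l ?mulr_ge0// /b /f1 /f2 /= [leRHS]addrC /e mulrDr lerD//.
    rewrite le_eqVlt; apply/orP; left; apply/eqP.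
    rewrite [LHS](_ : _ = (i%:R `^ (- eta) * i%:R `^ (- (eta * betaDelta))) *
      (xi i `^ alphaw * xi i `^ (alphaM + alpharho + alphaDelta) *
       xi i `^ (alphaH * betaDelta + alphaV * (betaH * (1 + betaDelta))))).
      by rewrite -iD -!xiD; congr (_ `^ _ * _ `^ _); ring.
    by ring.
  rewrite [leLHS](_ : _ = (i%:R `^ (- eta) * i%:R `^ (- (eta * betaD))) *
    (xi i `^ alphaw * xi i `^ (2 * alphaM + 2 * alpharho + alphaD + alphaH) *
     xi i `^ (alphaH * betaD + alphaV * (betaH * (1 + betaD))))).
    rewrite -iD -!xiD (_ : - eta + - (eta * betaD) = - ((1 + betaD) * eta)).
      rewrite ler_wpM2l ?powR_ge0// ler_powR//.
      have : alphaV * betaH * (1 + betaD) <= alphaV * 1 * (1 + betaD).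
        by rewrite ler_wpM2r ?ler_wpM2l// addr_ge0// ltW.
      have : 0 <= betaH * (1 + betaD) by rewrite mulr_ge0// addr_ge0// ltW.
      lra.
    by ring.
  by ring.
- by move=> i; rewrite addr_ge0 ?mulr_ge0 ?powR_ge0.
- rewrite (eq_eseriesr (g := fun i => (f1 i + f2 i)%E))//.
  by rewrite nneseriesD ?lte_add_pinfty// => i _ _; rewrite lee_fin mulr_ge0 ?powR_ge0.
Qed.

Lemma summable_quadratic_gain (e : nat -> \bar R) K a gamma : 0 <= K -> a <= gamma ->
  (forall i, (1 <= i)%N -> (0 <= e i <= (K * i%:R `^ (- (2 * eta)))%:E)%E) ->
  (\sum_(1 <= i <oo) (i%:R `^ (- (2 * eta)) * xi i `^ gamma)%:E < +oo)%E ->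
  (\sum_(1 <= i <oo) (e i * (xi i `^ a)%:E) < +oo)%E.
Proof.
move=> K0 a_le eK; apply: (nneseries_dominated K0) => [i i1|i].
  have /andP[e0 eKi] := eK i i1.
  rewrite mule_ge0 ?lee_fin ?powR_ge0//=.
  apply: (le_trans (lee_wpmul2r _ eKi)); first by rewrite lee_fin powR_ge0.
  by rewrite -EFinM lee_fin -mulrA !ler_wpM2l ?powR_ge0// ler_powR.
by rewrite mulr_ge0 ?powR_ge0.
Qed.

(** The gains are deterministic, and comparisons between consecutive ones are those of
    [powR_sub_le]. *)
Lemma gain_second_moments t x i : proj_set S 0 t -> 0 < eta <= 1 -> (1 <= i)%N ->
  [/\ (0 <= 'E_(law S t x)[fun om => (gain S t x i om ^+ 2)%R]
         <= (c0 ^+ 2 * i%:R `^ (- (2 * eta)))%:E)%E,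
      (0 <= 'E_(law S t x)[fun om => (gain S t x i.+1 om * gain S t x i om)%R]
         <= (c0 ^+ 2 * i%:R `^ (- (2 * eta)))%:E)%E &
      (0 <= `|'E_(law S t x)[fun om => (gain S t x i.+1 om - gain S t x i om)%R]|
         <= (c0 * i%:R `^ (- (2 * eta)))%:E)%E].
Proof.
move=> R0 eta01 i1.
have i0 : 0 < i%:R :> R by rewrite ltr0n.
have /andP[gain_le gain_diff] := powR_sub_le eta01 i1; rewrite subr_ge0 in gain_le.
have sq : c0 ^+ 2 * i%:R `^ (- (2 * eta)) = (c0 * i%:R `^ (- eta)) ^+ 2.
  rewrite exprMn -(powR_mulrn 2 (powR_ge0 _ _)) -powRrM.
  by congr (_ * _ `^ _); ring.
have constE (a : R) : ('E_(law S t x)[fun=> a] = a%:E)%E by exact: expectation_cst.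
have E f a : (forall om, f om = a) -> ('E_(law S t x)[f] = a%:E)%E.
  by move=> fa; rewrite -constE; congr ('E_ _ [ _ ])%E; apply/funext.
split.
- rewrite (E _ ((c0 * i%:R `^ (- eta)) ^+ 2)) => [|om]; last by rewrite hgain.
  by rewrite !lee_fin sq lexx sqr_ge0.
- rewrite (E _ (c0 * i.+1%:R `^ (- eta) * (c0 * i%:R `^ (- eta)))) => [|om].
    rewrite !lee_fin sq !mulr_ge0 ?powR_ge0//= expr2.
    by rewrite ler_wpM2r ?mulr_ge0 ?powR_ge0// ler_wpM2l.
  by rewrite !hgain.
- rewrite (E _ (c0 * i.+1%:R `^ (- eta) - c0 * i%:R `^ (- eta))) => [|om].
    rewrite abse_ge0 lee_fin -mulrBr normrM (ger0_norm c00).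
    by rewrite ler_wpM2l// distrC ger0_norm// subr_ge0.
  by rewrite !hgain.
Qed.

End expanding_projections.

(** * Condition (P) *)

Theorem proposition3p17 (R : realType) (d : nat)
    (dX : measure_display) (X : measurableType dX)
    (dO : measure_display) (Om : measurableType dO)
    (S : scheme R d X Om) (xi : nat -> R) (alphaw c0 eta : R)
    (V : X -> R)
    (c betaH alphaH alphaV alphaM alpharho : R)
    (alphaD betaD alphaDelta betaDelta : R)
    (hS : sa_process S)
    (halphaw : 0 < alphaw) (hW : cond_W S xi alphaw)
    (heta : 2^-1 < eta <= 1)
    (hgain : forall t x i om, proj_set S 0 t -> (1 <= i)%N ->
       gain S t x i om = c0 * i%:R `^ (- eta))
    (hstat : forall t t', hatTheta S t -> hatTheta S t' ->
       forall A, measurable A -> stat S t A = stat S t' A)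
    (hVmeas : measurable_fun setT V) (hV1 : forall x, 1 <= V x)
    (hbetaH : 0 < betaH <= 2^-1) (halphaH : 0 <= alphaH)
    (halphaV : 0 <= alphaV)
    (ha_drift : drift_bound S V xi c alphaH betaH)
    (ha_moment : moment_bound S V xi c alphaV)
    (hb : cond_G S V xi alphaM alpharho)
    (hc : cond_C S V xi betaH alphaD betaD alphaDelta betaDelta)
    (hbetaD : 0 < betaD <= betaH^-1 - 1)
    (hbetaDelta : 0 < betaDelta <= betaH^-1 - 1)
    (hd : forall t x i, proj_set S 0 t ->
       {ae law S t x, forall om,
         enorm (param S t x i.+1 om - param S t x i om)
         <= enorm (param_star S t x i.+1 om - param S t x i om)})
    (he1 : (\sum_(1 <= i <oo)
       (i%:R `^ (- ((1 + betaD) * eta))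
        * xi i `^ (alphaw + 2 * alphaM + 2 * alpharho + alphaD
                   + (betaD + 1) * (betaH + alphaV + alphaH)))%:E < +oo)%E)
    (he2 : (\sum_(1 <= i <oo)
       (i%:R `^ (- ((1 + betaDelta) * eta))
        * xi i `^ (alphaw + alphaM + alpharho + alphaDelta
                   + betaDelta * alphaH
                   + (betaDelta + 1) * betaH * alphaV))%:E < +oo)%E)
    (he3 : (\sum_(1 <= i <oo)
       (i%:R `^ (- (2 * eta))
        * xi i `^ (2 * alphaw
                   + 2 * (alphaH + alphaM + alpharho + betaH + alphaV)))%:E
       < +oo)%E) :
  cond_P S xi alphaw.
Proof.
have [hset hproc] := hS.
have [w [[_ _ _] [hR hTheta] _ _ [_ xi1 _ _]]] := hW.
have [alphaM0 alpharho0 /(_ betaH) hG] := hb.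
have [[alphaD0 betaD0 alphaDelta0 betaDelta0] /(_ betaH) hK [cDelta hDelta]] := hc.
have betaH_gt0 : 0 < betaH by case/andP: hbetaH.
have betaH_le : betaH <= 2^-1 by case/andP: hbetaH.
have betaH1 : 0 < betaH <= 1 by rewrite betaH_gt0 (le_trans betaH_le)//; lra.
have eta01 : 0 < eta <= 1 by case/andP: heta => h ->; rewrite andbT; lra.
have [M [rho [cG [cG0 Mrho erg GR]]]] := hG betaH1.
have [D [cD [_ D0 contD DR]]] := hK betaH1.
have ergj (j : 'I_d) t : hatTheta S t ->
    geom_ergodic (kern S t) (stat S t) (fun x => V x `^ betaH) (M t) (rho t).
  move=> ht; have [M0 rho01] := Mrho t ht.
  apply: (coord_geom_ergodic hVmeas hV1 j M0 rho01 (ltW betaH_gt0)).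
  exact: erg.
have Mle i t : proj_set S i t -> M t <= cG * xi i `^ alphaM.
  exact: (ereal_sup_image_le (GR i).1).
have rhole i t : proj_set S i t -> (1 - rho t)^-1 <= cG * xi i `^ alpharho.
  exact: (ereal_sup_image_le (GR i).2).
have hD (j : 'I_d) t t' : hatTheta S t -> hatTheta S t' -> forall phi C,
    dominated (fun x => V x `^ betaH) C phi ->
    forall x, `|kint (kern S t) phi x - kint (kern S t') phi x|
      <= C * (D t t' * enorm (t - t') `^ betaD) * V x `^ betaH.
  move=> ht ht'; apply: (coord_kernel_continuity hV1 j).
    by rewrite mulr_ge0 ?powR_ge0 ?D0.
  exact: contD.
have Dle i t t' : proj_set S i t -> proj_set S i t' -> D t t' <= cD * xi i `^ alphaD.
  move=> Rt Rt'; rewrite -lee_fin; apply: le_trans (DR i).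
  by apply: ereal_sup_ubound; exists t => //; exists t'.
have hDelta' i t t' : proj_set S i t -> proj_set S i t' -> forall x,
    enorm (drift S t x - drift S t' x) <=
    cDelta * xi i `^ alphaDelta * enorm (t - t') `^ betaDelta * V x `^ betaH.
  by move=> Rt Rt' x; have /le_vnorm := hDelta _ _ _ Rt Rt'; exact.
have scale beta : beta <= betaH^-1 - 1 -> betaH * (1 + beta) <= 1.
  move=> h; rewrite -ler_pdivlMl// mulr1; lra.
have c_ge0 : 0 <= c := drift_cst_ge0 hset hV1 xi1 ha_drift point.
(* The gains are nonnegative, and the first one is [c0]. *)
have c00 : 0 <= c0.
  have [[_ [t0 R0]] _ _ _] := hset.
  have [_ [_ _ mg] _ _ _] := hproc t0 point R0.
  by have := (mg 1%N isT).2 point; rewrite hgain// powR1 mulr1.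
split => //.
  move=> t x i R0 E B _ mB.
  have gE : gain S t x i.+1 = cst (c0 * i.+1%:R `^ (- eta)).
    by apply/funext => om; exact: hgain.
  rewrite gE preimage_cst; case: ifPn => _.
    rewrite setIT [X in (_ * X)%E](_ : _ = 1%E) ?mule1//.
    exact: probability_setT.
  by rewrite setI0 measure0 mule0.
exists (poisson_field S); split.
  by move=> t ht; exact: (poisson_field_solution hset hTheta ha_drift ergj).
exists V; split => //.
(* Condition (P) asks for one constant in the three bounds, so the bounds are added. *)
pose c' := 6 * d%:R * c * cG ^+ 2.
have c'0 : 0 <= c' by rewrite !mulr_ge0 ?exprn_ge0.
exists (c + c'), betaH, betaH, (alphaH + alphaM + alpharho), alphaH, alphaV.
split.
- by rewrite (ltW betaH_gt0) betaH_le !addr_ge0.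
- move=> i t x R0; apply: (le_trans (ha_drift i t x R0)).
  by rewrite lee_fin !ler_wpM2r ?powR_ge0// lerDl.
- move=> i t x R0; apply: (le_trans (ha_moment i t x R0)).
  rewrite lee_fin !ler_wpM2r ?powR_ge0//; last by rewrite lerDl.
  exact: le_trans (hV1 x).
- move=> i t x R0; apply: ge_ereal_sup => _ [t' Rt' <-]; rewrite lee_fin.
  have /= h := poisson_field_le hset hTheta hV1 xi1 ha_drift ergj
    Mle rhole x Rt'.
  apply: le_trans h _.
  by rewrite !ler_wpM2r ?powR_ge0// lerDr.
move=> t x R0 E Gam; split.
- split.
    move=> i i1.
    exact: (measurable_poisson_increment hset hproc hTheta ha_drift ergj).
  apply: (summable_poisson_increment hset hproc hR hTheta hVmeas hV1 xi1
    ha_drift cG0 ergj Mle rhole hstat D0 hD Dle hDelta' c00 hgain ha_moment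
    hd x R0 eta01 _ halphaV betaD0 _ betaDelta0 _ he1 he2).
  + by rewrite (ltW betaH_gt0); case/andP: betaH1.
  + by apply: scale; case/andP: hbetaD.
  + by apply: scale; case/andP: hbetaDelta.
- apply: (summable_quadratic_gain xi1 (sqr_ge0 c0) _ _ he3) => [|i i1].
    rewrite lerD2l ler_wpM2l// ge_max.
    have : betaH * alphaV <= 1 * alphaV by rewrite ler_wpM2r//; case/andP: betaH1.
    by move=> h; apply/andP; split; lra.
  by have [] := gain_second_moments c00 hgain x R0 eta01 i1.
- apply: (summable_quadratic_gain xi1 (sqr_ge0 c0) _ _ he3) => [|i i1].
    have : betaH * alphaV <= 1 * alphaV by rewrite ler_wpM2r//; case/andP: betaH1.
    by move=> h; lra.
  by have [] := gain_second_moments c00 hgain x R0 eta01 i1.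
- apply: (summable_quadratic_gain xi1 c00 _ _ he3) => [|i i1].
    have : betaH * alphaV <= 1 * alphaV by rewrite ler_wpM2r//; case/andP: betaH1.
    by move=> h; lra.
  by have [] := gain_second_moments c00 hgain x R0 eta01 i1.
Qed.
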